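(* Let $p$ be an odd prime and $F$ a field of characteristic $0$ with algebraic closure $\overline{F}$. Let $G$ be a finite metabelian group with a maximal abelian normal subgroup $K$ which is cyclic of order $p^n$, $n$ a positive integer, and which contains the derived subgroup $G'$. Let $\rho$ be a faithful irreducible $\overline{F}$-representation of $G$ with character $\chi$, and let $\lambda$ be a (faithful) irreducible constituent over $\overline{F}$ of the restriction of $\rho$ to $K$. Let $$I=\{g\in G : \text{there exists } \tau(g)\in \mathrm{Gal}(F(\lambda)/F) \text{ such that } \lambda^g=\lambda^{\tau(g)}\}.$$ Then the following hold. (1) $\rho$ is equivalent to the induced representation $\mathrm{Ind}_K^G\lambda$, $F(\lambda)=F(\zeta_{p^n})$, and $I/K\cong \mathrm{Gal}(F(\lambda)/F(\chi))$ is a cyclic group. (2) Suppose that $I=G$, and let $G/K=\langle yK\rangle\cong C_d$ for some $y\in G$. Then there exists an automorphism $\sigma$ of $F(\lambda)$ such that $\lambda^y=\lambda^\sigma$; moreover, the Wedderburn component of $F[G]$ corresponding to $\rho$ is isomorphic to the matrix algebra $M_d(F(\chi))$, and $F(\chi)$ is the subfield of $F(\lambda)$ fixed by $\sigma$.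
   Context: A maximal abelian normal subgroup of $G$ is a subgroup maximal among the abelian normal subgroups of $G$. $\zeta_m$ denotes a primitive $m$-th root of unity in $\overline{F}$ and $C_d$ a cyclic group of order $d$. For a character $\psi$ with values in $\overline{F}$, $F(\psi)$ is the field obtained from $F$ by adjoining all values of $\psi$. Here $\lambda$ is one-dimensional and is identified with its character $K\to\overline{F}^*$. For $g\in G$, $\lambda^g(h)=\lambda(ghg^{-1})$ for $h\in K$; for an automorphism $\tau$ of $F(\lambda)$, $\lambda^\tau(h)=\tau(\lambda(h))$. The Wedderburn component of $F[G]$ corresponding to $\rho$ (equivalently to $\chi$) is $F[G]e$, where $e$ is the unique primitive central idempotent of $F[G]$ with $\chi(e)\neq 0$ ($\chi$ extended linearly to $F[G]$). *)

(* Defs.v *)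
From HB Require Import structures.
From mathcomp Require Import all_boot all_order all_algebra all_fingroup.
From mathcomp Require Import all_solvable all_field all_character.
From mathcomp Require Import boolp classical_sets.

Set Implicit Arguments.
Unset Strict Implicit.
Unset Printing Implicit Defensive.

Import GroupScope GRing.Theory.
Local Open Scope ring_scope.

Section Adjunction.

Variables (F E : fieldType) (iota : {rmorphism F -> E}) (S : E -> Prop).

(* F(S): the intersection of all subfields of E that contain F and S. *)
Definition adjoin : {pred E} :=
  fun x => `[< forall L : divringClosed E,
                 (forall a, iota a \in L) -> (forall s, S s -> s \in L) ->
                 x \in L >].

Lemma adjoin_divring_closed : divring_closed adjoin.
Proof.
split=> [|x y /asboolP Sx /asboolP Sy|x y /asboolP Sx /asboolP Sy];
  apply/asboolP => L LF LS.
- exact: rpred1.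
- by apply: rpredB; [apply: Sx | apply: Sy].
- by apply: rpred_div; [apply: Sx | apply: Sy].
Qed.

HB.instance Definition _ :=
  GRing.isDivringClosed.Build E adjoin adjoin_divring_closed.

Record adjoin_field := AdjoinField {
  adjoin_val :> E;
  adjoin_valP : adjoin_val \in adjoin
}.

HB.instance Definition _ := [isSub for adjoin_val].
HB.instance Definition _ := [Choice of adjoin_field by <:].
HB.instance Definition _ :=
  [SubChoice_isSubIntegralDomain of adjoin_field by <:].
HB.instance Definition _ :=
  [SubIntegralDomain_isSubField of adjoin_field by <:].

Lemma adjoin_base_subproof a : iota a \in adjoin.
Proof. by apply/asboolP => L LF _; apply: LF. Qed.

Definition adjoin_base (a : F) : adjoin_field :=
  AdjoinField (adjoin_base_subproof a).

(* Gal(F(S)/k), where k is a set of elements of E.  Automorphisms are compared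
   with =1. *)
Definition is_gal (k : E -> Prop)
    (tau : {rmorphism adjoin_field -> adjoin_field}) : Prop :=
  bijective tau /\ (forall x : adjoin_field, k (val x) -> tau x = x).

(* A group isomorphism between A and Gal(F(S)/k). *)
Definition isom_gal (aT : finGroupType) (A : {set aT}) (k : E -> Prop) : Prop :=
  exists f : aT -> {rmorphism adjoin_field -> adjoin_field},
    [/\ forall u, u \in A -> is_gal k (f u),
        {in A &, forall u v, f (u * v)%g =1 f u \o f v},
        {in A &, forall u v, f u =1 f v -> u = v} &
        forall tau, is_gal k tau -> exists2 u, u \in A & f u =1 tau].

End Adjunction.

Section CharacterFields.

Variables (F E : fieldType) (iota : {rmorphism F -> E}).
Variables (gT : finGroupType) (H : {set gT}) (psi : gT -> E).

Definition char_values : E -> Prop := fun x => exists2 h, h \in H & x = psi h.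

(* F(psi) as a subset of E, and as a type with its own field structure. *)
Definition charfield : {pred E} := adjoin iota char_values.
Notation charfieldT := (adjoin_field iota char_values).

(* psi^tau, for an endomap tau of F(psi); the default value of insubd is never
   used, since psi h belongs to F(psi) for h in H. *)
Definition gal_conj (tau : charfieldT -> charfieldT) (h : gT) : E :=
  val (tau (insubd (0 : charfieldT) (psi h))).

Definition grp_conj (g h : gT) : E := psi (g * h * g^-1)%g.

Definition gal_stabilizer (G : {set gT}) : {set gT} :=
  finset (fun g => (g \in G) &&
    `[< exists2 tau : {rmorphism charfieldT -> charfieldT},
          is_gal (fun x => exists a, x = iota a) tau &
          {in H, grp_conj g =1 gal_conj tau} >]).

End CharacterFields.

Section Representations.

Variables (E : fieldType) (gT : finGroupType).

Definition repr_char (G : {group gT}) n (rG : mx_representation E G n)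
  (g : gT) : E := \tr (rG g).

(* By Maschke's theorem every constituent occurs as a submodule in
   characteristic 0. *)
Definition irr_constituent (H : {group gT}) k (sH : mx_representation E H k)
    n (rH : mx_representation E H n) : Prop :=
  mx_irreducible sH /\
  exists (U : 'M[E]_n) (modU : mxmodule rH U), mx_rsim sH (submod_repr modU).

Variables (G H : {group gT}) (n : nat) (rH : mx_representation E H n).

(* Representations act on row vectors, so the (i, j) block of Ind_H^G rH (g)
   is rH (t_i g t_j^-1), where t_i runs over representatives of the right
   cosets of H in G, and blocks with t_i g t_j^-1 outside H vanish. *)
Definition coset_rep (i : 'I_#|G : H|) : gT :=
  repr (enum_val (i : 'I_#|rcosets H G|)).

Definition induced_block (g : gT) (i j : 'I_#|G : H|) : 'M[E]_n :=
  let h := (coset_rep i * g * (coset_rep j)^-1)%g in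
  if h \in H then rH h else 0.

Definition induced_mx (g : gT) : 'M[E]_(\sum_(i < #|G : H|) n) :=
  \mxblock_(i, j) induced_block g i j.

Lemma coset_repP (i : 'I_#|G : H|) :
  (H :* coset_rep i)%g = enum_val (i : 'I_#|rcosets H G|).
Proof.
have /rcosetsP[x Gx def_i] := enum_valP (i : 'I_#|rcosets H G|).
by rewrite /coset_rep def_i rcoset_repr.
Qed.

Lemma coset_rep_mem (i j : 'I_#|G : H|) :
  (coset_rep i * (coset_rep j)^-1 \in H)%g = (i == j).
Proof.
rewrite -mem_rcoset -[in RHS](inj_eq enum_val_inj) -!coset_repP.
apply/idP/eqP => [/rcoset_eqP -> // | <-]; exact: rcoset_refl.
Qed.

Lemma coset_rep_act (i : 'I_#|G : H|) g : g \in G ->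
  exists j : 'I_#|G : H|, (coset_rep i * g * (coset_rep j)^-1 \in H)%g.
Proof.
move=> Gg; have /rcosetsP[x Gx def_i] := enum_valP (i : 'I_#|rcosets H G|).
have Gxg : (H :* (x * g) \in rcosets H G)%g.
  by apply/rcosetsP; exists (x * g)%g => //; apply: groupM.
exists (enum_rank_in Gxg (H :* (x * g))%g).
rewrite -mem_rcoset coset_repP enum_rankK_in // rcosetM -def_i -coset_repP.
by rewrite -rcosetM rcoset_refl.
Qed.

Lemma induced_mx_repr : mx_repr G induced_mx.
Proof.
split=> [|g1 g2 Gg1 Gg2].
  rewrite -mxdiagZ /mxdiag /induced_mx; apply: eq_mxblock => i j.
  rewrite /induced_block mulg1 coset_rep_mem.
  case: eqVneq => [->|//]; last by rewrite conform_mx_id mulgV repr_mx1.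
rewrite /induced_mx mul_mxblock; apply: eq_mxblock => i k.
have [j Hj] := coset_rep_act i Gg1.
rewrite (bigD1 j) //= big1 ?addr0 => [|j' ne_j'j].
  rewrite /induced_block Hj.
  have -> : (coset_rep i * (g1 * g2) * (coset_rep k)^-1 =
    coset_rep i * g1 * (coset_rep j)^-1 *
      (coset_rep j * g2 * (coset_rep k)^-1))%g by rewrite !mulgA mulgKV.
  by rewrite groupMl //; case: ifP => Hk; rewrite ?mulmx0 // repr_mxM.
rewrite /induced_block ifN ?mul0mx //; apply: contra ne_j'j => Hj'.
rewrite eq_sym -coset_rep_mem.
have -> : (coset_rep j * (coset_rep j')^-1 =
  (coset_rep i * g1 * (coset_rep j)^-1)^-1 *
    (coset_rep i * g1 * (coset_rep j')^-1))%g.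
  by rewrite !invMg invgK !mulgA !mulgKV.
by rewrite groupM ?groupV.
Qed.

Canonical induced_repr := MxRepresentation induced_mx_repr.

End Representations.

(* F[G] is the matrix algebra group_ring F G spanned by the regular
   representation; gring_row lists the coefficients of its elements. *)
Section GroupAlgebra.

Variables (F E : fieldType) (iota : {rmorphism F -> E}).
Variables (gT : finGroupType) (G : {group gT}).

Definition gring_coef (a : 'M[F]_#|G|) (g : gT) : F :=
  gring_row a 0 (gring_index G g).

Definition gring_ext (chi : gT -> E) (a : 'M[F]_#|G|) : E :=
  \sum_(g in G) iota (gring_coef a g) * chi g.

Definition central_idempotent (e : 'M[F]_#|G|) : Prop :=
  (e \in 'Z(group_ring F G))%MS /\ e *m e = e.

Definition primitive_central_idempotent (e : 'M[F]_#|G|) : Prop :=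
  [/\ central_idempotent e, e <> 0 &
      forall e1 e2, central_idempotent e1 -> central_idempotent e2 ->
        e1 *m e2 = 0 -> e = e1 + e2 -> e1 = 0 \/ e2 = 0].

(* The primitive central idempotent e with chi(e) != 0, which is unique when
   chi is an irreducible character and char F = 0; otherwise, if no such e
   exists, 0. *)
Definition wedderburn_idem (chi : gT -> E) : 'M[F]_#|G| :=
  xget 0 (fun e => primitive_central_idempotent e /\ gring_ext chi e <> 0).

Definition wedderburn_component (chi : gT -> E) : 'M[F]_#|G| -> Prop :=
  fun a => exists2 b, (b \in group_ring F G)%MS & a = b *m wedderburn_idem chi.

(* Isomorphism of unital F-algebras from the Wedderburn component of chi, whose
   unit is wedderburn_idem chi, to the algebra of d x d matrices over F(S). *)
Definition wedderburn_isom_matrix (chi : gT -> E) (S : E -> Prop) (d : nat) :=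
  let W := wedderburn_component chi in
  exists f : 'M[F]_#|G| -> 'M[adjoin_field iota S]_d,
    [/\ forall a b, W a -> W b -> f (a + b) = f a + f b,
        forall (c : F) a, W a -> f (c *: a) = adjoin_base iota S c *: f a,
        forall a b, W a -> W b -> f (a *m b) = f a *m f b,
        f (wedderburn_idem chi) = 1%:M &
        (forall a b, W a -> W b -> f a = f b -> a = b) /\
        (forall M, exists2 a, W a & f a = M)].

End GroupAlgebra.

(* Main.v *)
(** Since K is a maximal abelian normal subgroup containing G', it is its own
    centralizer, so G/K embeds in the cyclic group Aut K and the conjugates
    lambda^g are distinct for distinct cosets gK. The restriction of chi to K is
    the sum of these conjugates and chi vanishes off K; orthogonality of linear
    characters then shows that an automorphism of F(lambda) fixes F(chi) exactly
    when it acts on lambda as conjugation by an element of G.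

    When I = G, let sigma be the automorphism induced by y. Because p is odd,
    the Tate group H^0(G/K, K) vanishes, so y can be chosen in its coset with
    y^d = 1 and G is a split extension. Then G acts on F(lambda) by
    F(chi)-linear maps, K by multiplication through lambda and y through sigma.
    This realizes rho over F(chi), and F[G] maps onto M_d(F(chi)) since F[K]
    already yields F(lambda), in particular all scalars of F(chi). The kernel of
    this map is generated by a central idempotent, so M_d(F(chi)) is a
    Wedderburn component. *)
Require Import Defs.
From HB Require Import structures.
From mathcomp Require Import all_boot all_order all_algebra all_fingroup.
From mathcomp Require Import all_solvable all_field all_character.
From mathcomp Require Import boolp zify ring.
Set Implicit Arguments.
Unset Strict Implicit.
Unset Printing Implicit Defensive.
Import GroupScope GRing.Theory.

(** * Extensions of a cyclic group by a cyclic p-group *)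

(** The exponent of a norm: if [x ^ y = x ^+ r], then [(y * x ^+ j) ^+ i = y ^+ i * x ^+ (j *
    geom_sum r i)]. *)
Definition geom_sum (r k : nat) : nat := (\sum_(i < k) r ^ i)%N.

Lemma geom_sumS r k : geom_sum r k.+1 = (geom_sum r k * r + 1)%N.
Proof.
rewrite /geom_sum big_ord_recl expn0 addnC big_distrl /=; congr (_ + _)%N.
by apply: eq_bigr => i _; rewrite /bump add1n expnSr.
Qed.

(** The base is written [q.+1] so that the factor r - 1 involves no truncated subtraction. *)
Lemma geom_sum_mul q k : (q * geom_sum q.+1 k = q.+1 ^ k - 1)%N.
Proof.
elim: k => [|k IHk]; first by rewrite /geom_sum big_ord0 muln0.
rewrite geom_sumS mulnDr mulnA IHk expnSr.
have := expn_gt0 q.+1 k; move: (q.+1 ^ k)%N => N; nia.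
Qed.

Lemma geom_sumM r a b :
  geom_sum r (a * b) = (geom_sum r a * geom_sum (r ^ a) b)%N.
Proof.
elim: b => [|b IHb]; first by rewrite muln0 /geom_sum !big_ord0 muln0.
rewrite mulnS addnC {1}/geom_sum big_split_ord /= -/(geom_sum _ _) IHb.
rewrite [geom_sum (r ^ a) b.+1]/geom_sum big_ord_recr /= -/(geom_sum _ _)
  mulnDr.
congr (_ + _)%N; rewrite /geom_sum big_distrl /=; apply: eq_bigr => i _.
by rewrite expnD expnM mulnC.
Qed.

(** With r = 1 + p t, the sum is p + p t C(p, 2) modulo p^2, and p divides C(p, 2) because p is
    odd. *)
Lemma logn_geom_sum_prime p r : prime p -> odd p -> r = 1 %[mod p] ->
  logn p (geom_sum r p) = 1%N.
Proof.
move=> p_pr p_odd r1; have p_gt2 : (2 < p)%N := odd_prime_gt2 p_odd p_pr.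
have p2 : (p ^ 2 = p * p)%N by rewrite expnS expn1.
have [t def_r] : exists t, r = (1 + p * t)%N.
  exists (r %/ p); rewrite {1}(divn_eq r p) r1 modn_small;
    first by rewrite mulnC addnC.
  by rewrite ltnW.
have pow i : r ^ i = 1 + i * (p * t) %[mod p ^ 2].
  elim: i => [|i IHi]; first by rewrite mul0n.
  rewrite expnSr -modnMml IHi modnMml def_r.
  have -> : ((1 + i * (p * t)) * (1 + p * t) = i * t * t * p ^ 2 +
    (1 + i.+1 * (p * t)))%N.
    rewrite p2; lia.
  by rewrite modnMDl.
have sum_mod : geom_sum r p = p %[mod p ^ 2].
  rewrite /geom_sum -modn_summ (eq_bigr
    (fun i : 'I_p => ((1 + i * (p * t)) %% p ^ 2)%N)).
    rewrite modn_summ big_split /= sum_nat_const card_ord muln1 -big_distrl /=.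
    rewrite -(big_mkord xpredT (fun i => i)) triangular_sum.
    have /dvdnP[u ->] : (p %| 'C(p, 2))%N by apply: prime_dvd_bin.
    have -> : (u * p * (p * t) = u * t * p ^ 2)%N by rewrite p2; lia.
    by rewrite addnC modnMDl.
  by move=> i _; rewrite pow.
have p_gt0 := prime_gt0 p_pr.
have sum_gt0 : (0 < geom_sum r p)%N.
  case: (posnP (geom_sum r p)) => // s0.
  move: sum_mod; rewrite s0 mod0n modn_small; last by rewrite p2; nia.
  by move=> p0; rewrite -p0 in p_gt0.
apply/eqP; rewrite eqn_leq -pfactor_dvdn // andbC expn1.
rewrite -[X in X && _](_ : (p %| geom_sum r p %% p ^ 2) = _)%N; last first.
  by rewrite /dvdn modn_dvdm // p2 dvdn_mulr.
rewrite leqNgt sum_mod -pfactor_dvdn // /dvdn sum_mod.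
rewrite [(p %% p ^ 2)%N]modn_small; last by rewrite p2; nia.
by rewrite modnn eqxx -lt0n p_gt0.
Qed.

Lemma expn_eq1_mod p r a : r = 1 %[mod p] -> r ^ a = 1 %[mod p].
Proof. by move=> r1; rewrite -modnXm r1 modnXm exp1n. Qed.

(** [geom_sumM] splits off one factor p at a time, and each step adds valuation 1 since r^(p^s) is
    again 1 modulo p. *)
Lemma logn_geom_sum p r s : prime p -> odd p -> r = 1 %[mod p] ->
  logn p (geom_sum r (p ^ s)) = s.
Proof.
move=> p_pr p_odd r1; have gt0 q k : (0 < k -> 0 < geom_sum q k)%N.
  by case: k => // k _; rewrite geom_sumS addn1.
elim: s => [|s IHs]; first by rewrite /geom_sum big_ord_recl big_ord0 logn1.
have lp := logn_geom_sum_prime p_pr p_odd (expn_eq1_mod (p ^ s) r1).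
rewrite expnSr geom_sumM lognM ?IHs ?lp ?addn1 //; apply: gt0.
  by rewrite expn_gt0 prime_gt0.
exact: prime_gt0.
Qed.

Section CyclicByCyclic.

Variables (p n : nat) (gT : finGroupType) (G K : {group gT}) (y : gT).
Hypotheses (p_pr : prime p) (p_odd : odd p).
Hypotheses (nsKG : K <| G) (cycK : cyclic K) (oK : #|K| = (p ^ n)%N).
Hypotheses (cGK : 'C_G(K) \subset K) (Gy : y \in G).

(* The Tate group H^0(<yK>, K) vanishes since p is odd: the norm
   1 + r + ... + r^(d - 1) maps K onto the centralizer of y in K, where y acts
   as x |-> x^r; hence y^d is a norm. *)
Lemma cyclic_pgroup_ext_split :
  exists y', [/\ y' \in G, coset K y' = coset K y & y' ^+ #[coset K y] = 1].
Proof.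
have [x defK] := cyclicP cycK; set d := #[coset K y].
have ox : #[x] = (p ^ n)%N by rewrite -oK defK.
have Kx : x \in K by rewrite defK cycle_id.
have sKG := normal_sub nsKG; have nKG := normal_norm nsKG.
have Ny : y \in 'N(K) := subsetP nKG y Gy.
have Kdvd i : (y ^+ i \in K) = (d %| i)%N.
  rewrite order_dvdn -morphX //; apply/idP/eqP => [|/coset_idr -> //];
    last exact: groupX.
  exact: coset_id.
have [r xy] : exists r, x ^ y = x ^+ r.
  by apply/cycleP; rewrite -defK memJ_norm.
have xyi i : x ^ (y ^+ i) = x ^+ (r ^ i).
  elim: i => [|i IHi]; first by rewrite expg0 conjg1 expg1.
  by rewrite expgSr conjgM IHi conjXg xy -expgM expnS.
(* As [K] is self-centralizing, a power of [y] lies in [K] exactly when it fixes the generator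
   [x]. *)
have Kr i : (y ^+ i \in K) = (r ^ i == 1 %[mod p ^ n])%N.
  rewrite -ox -eq_expg_mod_order expg1 -xyi; apply/idP/eqP => [Kyi|cxyi].
    by apply/conjg_fixP/commgP; apply: (centsP (cyclic_abelian cycK)).
  apply: (subsetP cGK); rewrite inE groupX //= defK cent_cycle.
  by apply/cent1P/commute_sym/commgP/conjg_fixP.
have Kyd : y ^+ d \in K by rewrite Kdvd.
have [c yd] : exists c, y ^+ d = x ^+ c by apply/cycleP; rewrite -defK.
(* [y] commutes with its own power [y ^+ d = x ^+ c]. *)
have cr : c * r = c %[mod p ^ n].
  apply/eqP; rewrite -ox -eq_expg_mod_order mulnC expgM -xy -conjXg -yd.
  by apply/eqP/conjg_fixP/commgP/commute_sym/commuteX.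
have r_gt0 : (0 < n -> 0 < r)%N.
  move=> n_gt0; rewrite lt0n; apply/eqP => r0; move: xy; rewrite r0 expg0.
  move/eqP; rewrite -(conj1g y) (inj_eq (conjg_inj y)) -order_eq1 ox.
  by rewrite -(expn0 p) eqn_exp2l ?prime_gt1 // => /eqP n0; rewrite n0 in n_gt0.
have [n0|n_gt0] := posnP n.
  by exists y; split=> //; apply/eqP; rewrite yd -order_dvdn ox n0 expn0 dvd1n.
have{r_gt0} := r_gt0 n_gt0; case def_r: r => [//|q] _.
have{cr} cq : (p ^ n %| c * q)%N.
  by move/eqP: cr; rewrite def_r mulnS -{3}[c]addn0 eqn_modDl mod0n.
(* If p does not divide [q] = r - 1, then [cq] forces p^n to divide [c], so [y ^+ d = 1] already. *)
have [p_q|p'q] := boolP (p %| q)%N; last first.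
  exists y; split=> //; apply/eqP; rewrite yd -order_dvdn ox.
  by rewrite -(Gauss_dvdl _ (_ : coprime _ q)) // coprime_pexpl //
    prime_coprime.
have r1 : r = 1 %[mod p].
  by apply/eqP; rewrite def_r -addn1 -{2}[1%N]add0n eqn_modDr mod0n.
have Kyps i : (y ^+ (p ^ i) \in K) = (p ^ n %| q * geom_sum r (p ^ i))%N.
  rewrite Kr eqn_mod_dvd ?expn_gt0 ?def_r //; by rewrite geom_sum_mul.
have S_gt0 i : (0 < geom_sum r (p ^ i))%N.
  by rewrite -(prednK (_ : 0 < p ^ i)%N) ?geom_sumS ?addn1 // expn_gt0
    prime_gt0.
have [s def_d] : exists s, d = (p ^ s)%N.
  have : (d %| p ^ n)%N.
    rewrite -Kdvd Kyps dvdn_mull // pfactor_dvdn ?S_gt0 //.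
    by rewrite logn_geom_sum.
  by case/(dvdn_pfactor _ _ p_pr) => s _; exists s.
have [s0|s_gt0] := posnP s.
  exists 1; rewrite group1 expg1n; split=> //.
  by rewrite morph1 coset_id // -[y]expg1 Kdvd def_d s0.
have q_gt0 : (0 < q)%N.
  have : y ^+ (p ^ s.-1) \notin K.
    by rewrite Kdvd def_d dvdn_Pexp2l ?prime_gt1 // -ltnNge prednK.
  by rewrite Kyps; case: (q) => //; rewrite mul0n dvdn0.
(* With v the p-adic valuation: [y ^+ (p ^ s.-1)] lies outside [K], so v(q) + s - 1 < n; since n <=
   v(c) + v(q) by [cq], this gives v(c) >= s. *)
have p_c : (p ^ s %| c)%N.
  have [->|c_gt0] := posnP c; first exact: dvdn0.
  have : y ^+ (p ^ s.-1) \notin K.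
    by rewrite Kdvd def_d dvdn_Pexp2l ?prime_gt1 // -ltnNge prednK.
  move: cq; rewrite Kyps !pfactor_dvdn ?muln_gt0 ?q_gt0 ?S_gt0 ?c_gt0 //.
  by rewrite !lognM // logn_geom_sum //; clear -s_gt0; lia.
have [c' def_c] := dvdnP p_c.
have [u co_u defS] : exists2 u, coprime p u & geom_sum r d = (u * p ^ s)%N.
  have [u co_u def_S] := pfactor_coprime p_pr (S_gt0 s).
  by exists u; rewrite // def_d def_S logn_geom_sum.
have [j jS] : exists j, (p ^ n %| c + j * geom_sum r d)%N.
  have co_un : coprime u (p ^ n) by rewrite coprimeXr // coprime_sym.
  have u_gt0 : (0 < u)%N.
    by rewrite lt0n; apply/eqP => u0; move: (S_gt0 s); rewrite -def_d defS u0.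
  have [a b ab _] := egcdnP (p ^ n) u_gt0; rewrite (eqP co_un) in ab.
  (* [a] inverts [u] modulo p^n and [(p ^ n).-1] stands for -1, so the witness is -c'/u modulo
     p^n. *)
  exists (c' * a * (p ^ n).-1)%N; rewrite def_c defS.
  have -> : (c' * p ^ s + c' * a * (p ^ n).-1 * (u * p ^ s) =
     c' * p ^ s * (1 + (a * u) * (p ^ n).-1))%N by clear; lia.
  rewrite ab dvdn_mull //; have : (0 < p ^ n)%N by rewrite expn_gt0 prime_gt0.
  case: (p ^ n)%N => // N _; apply/dvdnP; exists (b * N + 1)%N.
  by rewrite -pred_Sn; clear; lia.
exists (y * x ^+ j).
have pow i : (y * x ^+ j) ^+ i = y ^+ i * x ^+ (j * geom_sum r i).
  elim: i => [|i IHi].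
    by rewrite !expg0 mul1g /geom_sum big_ord0 muln0.
  rewrite expgSr IHi geom_sumS expgSr -!mulgA; congr (_ * _).
  rewrite mulnDr muln1 expgD !mulgA; congr (_ * _).
  by rewrite mulnA [(_ * r)%N]mulnC (expgM x r) -xy -conjXg conjgC.
split.
- by rewrite groupM // groupX // (subsetP sKG).
- by rewrite coset_kerr ?groupX.
- by apply/eqP; rewrite pow yd -expgD -order_dvdn ox.
Qed.

End CyclicByCyclic.

Local Open Scope ring_scope.

(** * Fields generated by algebraic elements *)

Lemma natf_char0 (R : idomainType) : [pchar R] =i pred0 ->
  forall n, (0 < n)%N -> n%:R != 0 :> R.
Proof. by move=> R0 n n_gt0; apply/negP => /(natf0_pchar n_gt0)[q];
  rewrite R0. Qed.

Section AdjunctionTheory.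

Variables (F E : fieldType) (iota : {rmorphism F -> E}).

Lemma adjoin_base_additive S : zmod_morphism (adjoin_base iota S).
Proof. by move=> a b; apply: val_inj; rewrite /= !rmorphB. Qed.

Lemma adjoin_base_monoid S : monoid_morphism (adjoin_base iota S).
Proof.
by split=> [|a b]; apply: val_inj; rewrite /= ?rmorph1 ?rmorphM.
Qed.

HB.instance Definition _ S :=
  GRing.isZmodMorphism.Build _ _ (adjoin_base iota S) (adjoin_base_additive S).
HB.instance Definition _ S :=
  GRing.isMonoidMorphism.Build _ _ (adjoin_base iota S) (adjoin_base_monoid S).

Lemma adjoin_val_additive S : zmod_morphism (@adjoin_val F E iota S).
Proof. by []. Qed.

Lemma adjoin_val_monoid S : monoid_morphism (@adjoin_val F E iota S).
Proof. by []. Qed.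

HB.instance Definition _ S := GRing.isZmodMorphism.Build _ _
  (@adjoin_val F E iota S) (@adjoin_val_additive S).
HB.instance Definition _ S := GRing.isMonoidMorphism.Build _ _
  (@adjoin_val F E iota S) (@adjoin_val_monoid S).

Lemma mem_adjoin S s : S s -> s \in adjoin iota S.
Proof. by move=> Ss; apply/asboolP => L _; apply. Qed.

Lemma adjoin_sub S (P : {pred E}) :
    divring_closed P -> (forall a, iota a \in P) ->
    (forall s, S s -> s \in P) ->
  {subset adjoin iota S <= P}.
Proof.
move=> closedP PF PS x /asboolP Sx.
pose P' : divringClosed E := HB.pack P (GRing.isDivringClosed.Build E P
  closedP).
exact: (Sx P').
Qed.

(** Removing powers of X from an annihilating polynomial leaves x q(x) + a = 0 with a nonzero, so
    the inverse -q(x)/a is a polynomial in x. *)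
Lemma algebraic_inv_mem (P : {pred E}) x :
    subring_closed P -> (forall a, iota a \in P) ->
  x \in P -> algebraicOver iota x -> x^-1 \in P.
Proof.
move=> closedP PF Px [p p_nz px0].
have [-> | x_nz] := eqVneq x 0.
  by have [_ PB _] := closedP; rewrite invr0 -(subrr x) PB.
pose P' : subringClosed E := HB.pack P (GRing.isSubringClosed.Build E P
  closedP).
have [k [q + def_p]] := multiplicity_XsubC p 0; rewrite p_nz /=.
move: px0; rewrite {p p_nz}def_p subr0 rmorphM rmorphXn /= map_polyX /root.
rewrite hornerM hornerXn mulf_eq0 expf_eq0 (negPf x_nz) andbF orbF.
elim/poly_ind: q => [|q a _]; first by rewrite horner0 eqxx.
rewrite rmorphD rmorphM /= map_polyX map_polyC !hornerE => qx0 a_nz.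
have -> : x^-1 = (map_poly iota q).[x] * iota (- a^-1).
  apply: (mulIf x_nz); rewrite mulVf // rmorphN fmorphV /= mulrAC.
  by rewrite mulrN -mulNr (addr0_eq (eqP qx0)) mulfV ?fmorph_eq0.
have [_ _ PM] := closedP; rewrite PM ?PF //.
by apply: (rpred_horner (S := P')) => //; apply/polyOverP => i;
  rewrite coef_map; apply: PF.
Qed.

Lemma algebraic_divring_closed (P : {pred E}) :
    subring_closed P -> (forall a, iota a \in P) ->
  (forall x, algebraicOver iota x) -> divring_closed P.
Proof.
move=> closedP PF algE; have [P1 PB PM] := closedP; split=> // x y Px Py.
by rewrite PM // algebraic_inv_mem.
Qed.

Lemma fixed_divring_closed S
    (tau : {rmorphism adjoin_field iota S -> adjoin_field iota S}) :
  divring_closed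
    [pred x : E | `[< exists2 v : adjoin_field iota S,
      val v = x & tau v = v >]].
Proof.
split=> [|_ _ /asboolP[x <- fx] /asboolP[y <- fy]|_ _ /asboolP[x <- fx]
  /asboolP[y <- fy]];
  apply/asboolP.
- by exists 1; rewrite ?rmorph1.
- by exists (x - y); rewrite ?rmorphB ?fx ?fy.
- by exists (x / y); rewrite ?fmorph_div ?fx ?fy.
Qed.

End AdjunctionTheory.

Lemma sum_mulgl (V : nmodType) (gT : finGroupType) (G : {group gT}) x
    (f : gT -> V) :
  x \in G -> \sum_(g in G) f g = \sum_(g in G) f (x * g)%g.
Proof.
move=> Gx; rewrite (reindex_inj (mulgI x)).
by apply: eq_bigl => g; rewrite groupMl.
Qed.

Lemma sum_mulgr (V : nmodType) (gT : finGroupType) (G : {group gT}) x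
    (f : gT -> V) :
  x \in G -> \sum_(g in G) f g = \sum_(g in G) f (g * x)%g.
Proof.
move=> Gx; rewrite (reindex_inj (mulIg x)).
by apply: eq_bigl => g; rewrite groupMr.
Qed.

(** The [F]-span of the values of a linear character is a ring, and algebraicity makes it a field;
    hence it is all of F(lam). *)
Lemma charfield_span (F E : fieldType) (iota : {rmorphism F -> E})
    (gT : finGroupType) (K : {group gT}) (lam : gT -> E) :
    (forall x, algebraicOver iota x) -> lam 1%g = 1 ->
    {in K &, {morph lam : g h / (g * h)%g >-> g * h}} ->
  forall x, x \in charfield iota K lam ->
  exists c : gT -> F, x = \sum_(h in K) iota (c h) * lam h.
Proof.
move=> algE lin_char1 lin_charM.
pose P : {pred E} :=
  fun x => `[< exists c : gT -> F, x = \sum_(h in K) iota (c h) * lam h >].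
have sum1 g a : g \in K ->
    \sum_(h in K) iota (if h == g then a else 0) * lam h = iota a * lam g.
  move=> Kg; rewrite (bigD1 g) //= eqxx big1 ?addr0 // => h /andP[_ /negPf->].
  by rewrite rmorph0 mul0r.
suff sFP : {subset charfield iota K lam <= P} by move=> x /sFP/asboolP.
have PF a : iota a \in P.
  apply/asboolP; exists (fun h => if h == 1%g then a else 0).
  by rewrite sum1 ?group1 // lin_char1 mulr1.
apply: adjoin_sub => // [|_ [g Kg ->]]; last first.
  apply/asboolP; exists (fun h => if h == g then 1 else 0).
  by rewrite sum1 // rmorph1 mul1r.
apply: (algebraic_divring_closed (iota := iota)) => //.
split=> [|_ _ /asboolP[a ->] /asboolP[b ->]|_ _ /asboolP[a ->] /asboolP[b ->]].
- by rewrite -(rmorph1 iota).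
- apply/asboolP; exists (fun h => a h - b h); rewrite -sumrB.
  by apply: eq_bigr => h _; rewrite rmorphB mulrBl.
(* Products of such sums have the convolution of the coefficients as coefficients. *)
apply/asboolP; exists (fun h => \sum_(g in K) a g * b (g^-1 * h)%g).
rewrite mulr_suml; transitivity
    (\sum_(g in K) \sum_(h in K) iota (a g * b (g^-1 * h)%g) * lam h);
      last first.
  by rewrite exchange_big; apply: eq_bigr => h _; rewrite rmorph_sum mulr_suml.
apply: eq_bigr => g Kg; rewrite mulr_sumr.
rewrite [RHS](sum_mulgl _ Kg); apply: eq_bigr => h Kh.
by rewrite mulKg rmorphM lin_charM // mulrACA.
Qed.

Lemma big_ord_shift (R : Type) (idx : R) (op : Monoid.com_law idx) n
    (f : nat -> R) :
  f n = f 0 -> \big[op/idx]_(i < n) f i.+1 = \big[op/idx]_(i < n) f i.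
Proof.
case: n => [|n] fn0; first by rewrite !big_ord0.
by rewrite big_ord_recr big_ord_recl /= Monoid.mulmC fn0.
Qed.

(** [tau] permutes the linear factors cyclically; [z n = z 0] closes the cycle. *)
Lemma map_cyclic_prod_XsubC (R : comNzRingType) (tau : {rmorphism R -> R}) n
    (z : nat -> R) : (forall j, tau (z j) = z j.+1) -> z n = z 0 ->
  map_poly tau (\prod_(j < n) ('X - (z j)%:P)) = \prod_(j < n) ('X - (z j)%:P).
Proof.
move=> tau_z zn; pose f j : {poly R} := 'X - (z j)%:P.
rewrite map_prod_XsubC -[RHS](@big_ord_shift _ _ _ n f) /f ?zn //.
by apply: eq_bigr => j _; rewrite tau_z.
Qed.

(** * Two-sided ideals of the group algebra *)

Section CentralIdempotents.

Variables (F : fieldType) (gT : finGroupType) (G : {group gT}).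
Hypothesis F0 : [pchar F] =i pred0.
Local Notation nG := #|pred_of_set (gval G)|.
Local Notation aG := (regular_repr F G).
Local Notation R_G := (group_ring F G).

(** A matrix of maximal rank with row space inside [V] spans [V], since adjoining a further vector
    of [V] would raise the rank. *)
Lemma pred_rowspace N (V : 'rV[F]_N -> Prop) :
    V 0 -> (forall c u v, V u -> V v -> V (c *: u + v)) ->
  exists M : 'M_N, forall u, V u <-> (u <= M)%MS.
Proof.
move=> V0 VD; pose sub (M : 'M_N) := forall u : 'rV_N, (u <= M)%MS -> V u.
pose P k := `[< exists2 M, sub M & \rank M = k >].
have exP : exists k, P k.
  by exists 0%N; apply/asboolP; exists 0;
    rewrite ?mxrank0 // => u /submx0null->.
have leP k : P k -> (k <= N)%N by case/asboolP => M _ <-; apply: rank_leq_row.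
case: (ex_maxnP exP leP) => _ /asboolP[M subM <-] maxM.
exists M => u; split=> [Vu|]; last exact: subM.
have VM : sub (M + u)%MS.
  move=> w /sub_addsmxP[[a b] /= ->].
  rewrite [b]mx11_scalar mul_scalar_mx addrC; apply: VD => //.
  by apply: subM; apply: submxMl.
have /maxM rkM : P (\rank (M + u)%MS) by apply/asboolP; exists (M + u)%MS.
apply: submx_trans (addsmxSr M u) _.
by rewrite -(geq_leqif (mxrank_leqif_sup (addsmxSl M u))).
Qed.

(* Maschke's averaging, performed on both sides at once, turns a linear
   projection onto J into a projection of bimodules; f is the image of 1. *)
Lemma two_sided_ideal_idem (J : 'M[F]_nG -> Prop) :
    J 0 -> (forall c a b, J a -> J b -> J (c *: a + b)) ->
    (forall a, J a -> (a \in R_G)%MS) ->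
    (forall x a, x \in G -> J a -> J (aG x *m a) /\ J (a *m aG x)) ->
  exists f, [/\ J f, (f \in 'Z(R_G))%MS & forall a, J a -> f *m a = a].
Proof.
move=> J0 JD JR JG.
have [M JM] : exists M : 'M_(nG * nG), forall a, J a <-> (mxvec a <= M)%MS.
  have [||M JM] := @pred_rowspace (nG * nG) (fun u => J (vec_mx u)).
  - by rewrite linear0.
  - by move=> c u v Ju Jv; rewrite linearP; apply: JD.
  by exists M => a; rewrite -JM mxvecK.
pose pr : 'M[F]_nG -> 'M[F]_nG := vec_mx \o mulmxr (pinvmx M *m M) \o mxvec.
have Jpr a : J (pr a) by rewrite JM vec_mxK /= mulmxA submxMl.
have pr_id a : J a -> pr a = a.
  by rewrite JM => Ja; rewrite /pr /= mulmxA mulmxKpV // mxvecK.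
pose prL : {linear 'M[F]_nG -> 'M[F]_nG} := pr.
pose avg a := \sum_(g in G) \sum_(h in G)
  aG g^-1%g *m prL (aG g *m a *m aG h) *m aG h^-1%g.
pose f := (#|G|%:R ^- 2) *: avg 1%:M.
have nG_nz : #|G|%:R != 0 :> F by apply: natf_char0.
have JZ c a : J a -> J (c *: a) by move=> Ja; rewrite -[_ *: _]addr0; apply: JD.
have Jsum (I : finType) (P : pred I) (a : I -> 'M_nG) :
    (forall i, P i -> J (a i)) -> J (\sum_(i | P i) a i).
  by move=> Ja; elim/big_ind: _ => // u v Ju Jv; rewrite -[u]scale1r; apply: JD.
have Jf : J f.
  apply/JZ/Jsum => g Gg; apply: Jsum => h Gh;
    have [/groupVr Gg' /groupVr Gh'] := conj Gg Gh.
  by apply: (JG _ _ Gh' _).2; apply: (JG _ _ Gg' _).1; apply: Jpr.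
(* Translating a summation index shows that multiplying [avg 1%:M] by a group element on either side
   gives [avg] of that element; this makes [f] central. *)
have fl x : x \in G -> aG x *m avg 1%:M = avg (aG x).
  move=> Gx; rewrite /avg [RHS](sum_mulgr _ (groupVr Gx)) mulmx_sumr.
  apply: eq_bigr => g Gg; rewrite mulmx_sumr; apply: eq_bigr => h Gh.
  have [Vg Vx] := (groupVr Gg, groupVr Gx).
  rewrite invMg invgK (repr_mxM aG Gx Vg) (repr_mxM aG Gg Vx) !mulmxA.
  by rewrite (repr_mxKV aG Gx) mulmx1.
have fr x : x \in G -> avg 1%:M *m aG x = avg (aG x).
  move=> Gx; rewrite /avg mulmx_suml; apply: eq_bigr => g Gg.
  rewrite [RHS](sum_mulgl _ (groupVr Gx)) mulmx_suml; apply: eq_bigr => h Gh.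
  have [Vh Vx] := (groupVr Gh, groupVr Gx).
  rewrite invMg invgK (repr_mxM aG Vx Gh) (repr_mxM aG Vh Gx) !mulmxA mulmx1.
  by rewrite (repr_mxK aG Gx).
have avgD : {morph avg : a b / a + b}.
  move=> a b; rewrite -big_split; apply: eq_bigr => g Gg.
  rewrite -big_split; apply: eq_bigr => h Gh.
  by rewrite mulmxDr mulmxDl linearD /= mulmxDr mulmxDl.
have avgZ c : {morph avg : a / c *: a}.
  move=> a; rewrite scaler_sumr; apply: eq_bigr => g Gg.
  rewrite scaler_sumr; apply: eq_bigr => h Gh.
  by rewrite -scalemxAr -scalemxAl linearZ /= -scalemxAr -scalemxAl.
have avg0 : avg 0 = 0 by have := avgZ 0 0; rewrite !scale0r.
have avg_sum (a : gT -> F) :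
    avg (\sum_(x in G) a x *: aG x) = \sum_(x in G) a x *: avg (aG x).
  by rewrite (big_morph _ avgD avg0); apply: eq_bigr => x _; rewrite avgZ.
have f_avg a : (a \in R_G)%MS -> f *m a = (#|G|%:R ^- 2) *: avg a /\
  a *m f = (#|G|%:R ^- 2) *: avg a.
  case/envelop_mxP => c ->; rewrite /f -scalemxAl -scalemxAr avg_sum mulmx_sumr
    mulmx_suml.
  by split; congr (_ *: _); apply: eq_bigr => x Gx;
    rewrite -?scalemxAl -?scalemxAr ?fr ?fl.
exists f; split=> // [|a Ja].
  by apply/center_mxP; split=> [|a Ra];
    [exact: JR | have [-> ->] := f_avg a Ra].
have [-> _] := f_avg a (JR a Ja).
(* The projection is the identity on [J], so each of the #|G|^2 terms equals [a], and the scalar in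
   [f] cancels their number. *)
rewrite /avg (eq_bigr (fun=> a *+ #|G|)) => [|g Gg].
  rewrite sumr_const -mulrnA -scaler_nat scalerA natrM -expr2 mulVf ?scale1r //.
  by rewrite expf_neq0.
rewrite (eq_bigr (fun=> a)) ?sumr_const // => h Gh.
have -> : prL (aG g *m a *m aG h) = aG g *m a *m aG h.
  by apply: pr_id; apply: (JG _ _ Gh _).2; apply: (JG _ _ Gg _).1.
by rewrite !mulmxA -mulmxA -!repr_mxM ?groupV // mulVg mulgV repr_mx1 mul1mx
  mulmx1.
Qed.

End CentralIdempotents.

(** * Representations realized over the extension field *)

Section SplitWedderburnComponent.

Variables (F E : fieldType) (iota : {rmorphism F -> E}) (S : E -> Prop).
Variables (gT : finGroupType) (G : {group gT}) (chi : gT -> E).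
Local Notation k := (adjoin_field iota S).
Local Notation phi := (adjoin_base iota S).
Variables (d : nat) (rk : mx_representation k G d).
Hypothesis F0 : [pchar F] =i pred0.
Hypothesis chiE : {in G, forall g, chi g = val (\tr (rk g))}.
Hypothesis abs_rk : mx_absolutely_irreducible rk.
Hypothesis scal_rk : forall c : k,
  exists a : gT -> F, c%:M = \sum_(g in G) phi (a g) *: rk g.
Local Notation nG := #|pred_of_set (gval G)|.
Local Notation aG := (regular_repr F G).
Local Notation R_G := (group_ring F G).

(** The homomorphism F[G] -> M_d(k) extending [rk], semilinear along [phi]. *)
Definition gring_ext_op (a : 'M[F]_nG) : 'M[k]_d := gring_op rk (map_mx phi a).
Local Notation Phi := gring_ext_op.

Lemma gring_ext_op_linear c a b : Phi (c *: a + b) = phi c *: Phi a + Phi b.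
Proof. by rewrite /Phi map_mxD map_mxZ linearP. Qed.

Lemma gring_ext_opB a b : Phi (a - b) = Phi a - Phi b.
Proof. by rewrite /Phi map_mxB linearB. Qed.

Lemma gring_ext_op0 : Phi 0 = 0.
Proof. by rewrite /Phi map_mx0 linear0. Qed.

Lemma gring_ext_op1 : Phi 1%:M = 1%:M.
Proof. by rewrite /Phi map_mx1 gring_op1. Qed.

Lemma gring_ext_opZ c a : Phi (c *: a) = phi c *: Phi a.
Proof. by rewrite -[c *: a]addr0 gring_ext_op_linear gring_ext_op0 addr0. Qed.

Lemma gring_ext_op_sum (f : gT -> 'M_nG) :
  Phi (\sum_(g in G) f g) = \sum_(g in G) Phi (f g).
Proof.
apply: (big_morph Phi _ gring_ext_op0) => a b.
by rewrite -[a]scale1r gring_ext_op_linear rmorph1 !scale1r.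
Qed.

Lemma gring_ext_opG g : g \in G -> Phi (aG g) = rk g.
Proof. by move=> Gg; rewrite /Phi map_regular_mx gring_opG. Qed.

Lemma gring_ext_opM a b : (b \in R_G)%MS -> Phi (a *m b) = Phi a *m Phi b.
Proof.
move=> Rb; rewrite /Phi map_mxM gring_opM //.
by rewrite -(map_group_ring phi G) -map_mxvec map_submx.
Qed.

Lemma gring_extE a : gring_ext iota chi a = val (\tr (Phi a)).
Proof.
rewrite /Phi gring_opE /gring_mx /= mulmx_sum_row !linear_sum /=.
rewrite /gring_ext (reindex (enum_val (A := G))) /=; last first.
  exact: (enum_val_bij_in (group1 G)).
rewrite (eq_bigl xpredT) => [|i]; last exact: enum_valP.
rewrite [RHS]rmorph_sum.
apply: eq_bigr => i _.
rewrite !linearZ /= rowK mxvecK chiE ?enum_valP // /gring_coef.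
by rewrite gring_valK -map_gring_row !mxE.
Qed.

(** Absolute irreducibility makes the k-span of [rk] the full matrix algebra; [scal_rk] lifts the
    coefficients in k to F[G], so the F-span is already everything. *)
Lemma gring_ext_op_onto (M : 'M_d) : exists2 a, (a \in R_G)%MS & Phi a = M.
Proof.
have /envelop_mxP[m ->] : (M \in enveloping_algebra_mx rk)%MS.
  by have [_ full] := andP abs_rk; rewrite submx_full.
have /choice[b bP] : forall g, exists b : 'M[F]_nG,
    (b \in R_G)%MS /\ Phi b = (m g)%:M.
  move=> g; have [a ma] := scal_rk (m g).
  exists (\sum_(g in G) a g *: aG g); split.
    by apply/envelop_mxP; exists a.
  rewrite ma gring_ext_op_sum; apply: eq_bigr => h Gh.
  by rewrite gring_ext_opZ gring_ext_opG.
exists (\sum_(g in G) b g *m aG g).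
  rewrite linear_sum summx_sub // => g Gg.
  by rewrite envelop_mxM ?envelop_mx_id //; case: (bP g).
rewrite gring_ext_op_sum; apply: eq_bigr => g Gg.
rewrite gring_ext_opM ?envelop_mx_id // gring_ext_opG //.
by case: (bP g) => _ ->; rewrite mul_scalar_mx.
Qed.

(** By Schur's lemma the image is a scalar c, and c^2 = c. *)
Lemma central_idempotent_op e :
  central_idempotent e -> Phi e = 0 \/ Phi e = 1%:M.
Proof.
case=> /center_mxP[Re eC] ee.
have /(mx_abs_irr_cent_scalar abs_rk)/is_scalar_mxP[c ec] : centgmx rk (Phi e).
  apply/centgmxP => g Gg; have Rg := envelop_mx_id aG Gg.
  rewrite -(gring_ext_opG Gg) -(gring_ext_opM e Rg) -(gring_ext_opM _ Re).
  by rewrite (eC _ Rg).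
have d_gt0 : (0 < d)%N by case/andP: abs_rk.
have : c%:M *m c%:M = c%:M :> 'M_d by rewrite -ec -gring_ext_opM ?ee.
rewrite -scalar_mxM ec => /(congr1 (fun A : 'M_d =>
  A (Ordinal d_gt0) (Ordinal d_gt0))).
rewrite !mxE eqxx !mulr1n => /eqP; rewrite -subr_eq0 -{3}[c]mulr1 -mulrBr
  mulf_eq0.
by rewrite subr_eq0 => /orP[] /eqP->; [left; rewrite raddf0 | right].
Qed.

(* The kernel of F[G] -> M_d(k) is generated by a central idempotent f, and the
   component of chi is generated by 1 - f. *)
Lemma split_wedderburn_component : wedderburn_isom_matrix iota G chi S d.
Proof.
have d_gt0 : (0 < d)%N by case/andP: abs_rk.
have k0 : [pchar k] =i pred0 by move=> q; rewrite -F0 -(fmorph_pchar phi).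
have [f [[Rf f0] /center_mxP[_ fC] f_id]] :
    exists f, [/\ (f \in R_G)%MS /\ Phi f = 0, (f \in 'Z(R_G))%MS &
      forall a, (a \in R_G)%MS /\ Phi a = 0 -> f *m a = a].
  apply: (two_sided_ideal_idem F0 (J := fun a => (a \in R_G)%MS /\ Phi a = 0)).
  - by rewrite linear0 sub0mx gring_ext_op0.
  - move=> c a b [Ra a0] [Rb b0]; split.
      by rewrite linearP; apply: (addmx_sub (scalemx_sub c Ra) Rb).
    by rewrite gring_ext_op_linear a0 b0 scaler0 addr0.
  - by move=> a [].
  move=> x a Gx [Ra a0]; have Rx := envelop_mx_id aG Gx; split; split.
  - exact: (envelop_mxM Rx Ra).
  - by rewrite (gring_ext_opM _ Ra) a0 mulmx0.
  - exact: (envelop_mxM Ra Rx).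
  by rewrite (gring_ext_opM _ Rx) a0 mul0mx.
have ciR e : central_idempotent e -> (e \in R_G)%MS by case=> /center_mxP[].
have ciC e : central_idempotent e -> forall b,
  (b \in R_G)%MS -> b *m e = e *m b.
  by case=> /center_mxP[_ eC] _ b /eC.
have ff : f *m f = f by apply: f_id.
have ci_f : central_idempotent f by split=> //; apply/center_mxP.
have ciM (e1 e2 : 'M[F]_nG) : central_idempotent e1 -> central_idempotent e2 ->
    central_idempotent (e1 *m e2).
  move=> ci1 ci2; have R1 := ciR _ ci1; have R2 := ciR _ ci2.
  split; last first.
    by rewrite mulmxA -(mulmxA e1 e2 e1) (ciC _ ci1) // !mulmxA ci1.2 -mulmxA
      ci2.2.
  apply/center_mxP; split=> [|b Rb]; first exact: envelop_mxM.
  by rewrite mulmxA (ciC _ ci1) // -mulmxA (ciC _ ci2) // mulmxA.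
have ciB (e1 e2 : 'M[F]_nG) : central_idempotent e1 -> central_idempotent
  e2 -> e1 *m e2 = e2 ->
    central_idempotent (e1 - e2).
  move=> ci1 ci2 e12; have e21 : e2 *m e1 = e2 by rewrite (ciC _ ci1) ?ciR.
  split; last by rewrite mulmxBr !mulmxBl ci1.2 ci2.2 e12 e21 subrr subr0.
  apply/center_mxP; split=> [|b Rb].
    by rewrite linearB addmx_sub ?eqmx_opp ?ciR.
  by rewrite mulmxBl mulmxBr (ciC _ ci1) // (ciC _ ci2).
have ci1 : central_idempotent (1%:M : 'M[F]_nG).
  split; last by rewrite mul1mx.
  apply/center_mxP; split=> [|b _]; first exact: envelop_mx1.
  by rewrite mul1mx mulmx1.
(* [wedderburn_idem] is chosen by [xget], so it has these properties as soon as one idempotent does;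
   [1%:M - f] is the witness. *)
have [pe chi_e] : primitive_central_idempotent (wedderburn_idem iota G chi) /\
    gring_ext iota chi (wedderburn_idem iota G chi) <> 0.
  pose P (e : 'M[F]_nG) := primitive_central_idempotent e /\
    gring_ext iota chi e <> 0.
  suff exP : exists e, P e by apply: (@classical_sets.xgetPex _ 0 P exP).
  exists (1%:M - f).
  have Phi_e : Phi (1%:M - f) = 1%:M by rewrite gring_ext_opB gring_ext_op1 f0
    subr0.
  have chi_e : gring_ext iota chi (1%:M - f) <> 0.
    rewrite gring_extE Phi_e mxtrace1 => /(@val_inj _ _ _ _ 0)/eqP.
    by rewrite (negPf (natf_char0 k0 d_gt0)).
  split=> //; split=> [||e1 e2 ci_1 ci_2 e12 def_e].
  - by apply: ciB; rewrite ?mul1mx.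
  - by move=> e0; case: chi_e; rewrite e0 gring_extE gring_ext_op0 mxtrace0.
  have e21 : e2 *m e1 = 0 by rewrite (ciC _ ci_1) ?ciR.
  (* A summand [a] of 1 - f satisfies a = a (1 - f); if it lies in the kernel, then also f a = a,
     hence a = 0. *)
  have ker0 (a e' : 'M[F]_nG) : central_idempotent a -> a *m e' = 0 -> 1%:M - f
    = a + e' -> Phi a = 0 -> a = 0.
    move=> ci_a ae' def a0.
    have fa : f *m a = a by apply: f_id; split=> //; apply: ciR.
    have : a *m (1%:M - f) = a by rewrite def mulmxDr ci_a.2 ae' addr0.
    by rewrite mulmxBr mulmx1 (ciC _ ci_f) ?ciR // fa subrr.
  have [e1_0 | e1_1] := central_idempotent_op ci_1; first by left;
    apply: (ker0 _ _ ci_1 e12 def_e e1_0).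
  have [e2_0 | e2_1] := central_idempotent_op ci_2.
    by right; apply: (ker0 _ _ ci_2 e21 _ e2_0); rewrite def_e addrC.
  have := congr1 Phi e12; rewrite gring_ext_opM ?ciR // e1_1 e2_1 mul1mx
    gring_ext_op0.
  move/matrixP/(_ (Ordinal d_gt0) (Ordinal d_gt0)); rewrite !mxE eqxx => /eqP.
  by rewrite oner_eq0.
rewrite /wedderburn_isom_matrix /wedderburn_component.
move: (wedderburn_idem iota G chi) pe chi_e => e [ci_e _ prim_e] chi_e.
have Phi_e : Phi e = 1%:M.
  case: (central_idempotent_op ci_e) => // e0; case: chi_e.
  by rewrite gring_extE e0 mxtrace0.
(* Primitivity applies to e = e f + (e - e f); the second summand is nonzero because its image is
   1. *)
have ef0 : e *m f = 0.
  have ci_ef := ciM _ _ ci_e ci_f.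
  have eef : e *m (e *m f) = e *m f by rewrite mulmxA ci_e.2.
  have := prim_e _ _ ci_ef (ciB _ _ ci_e ci_ef eef); case=> //.
  - by rewrite mulmxBr ci_ef.2 (ciC _ ci_e) ?ciR // eef subrr.
  - by rewrite addrC subrK.
  move/(congr1 Phi); rewrite gring_ext_opB gring_ext_opM // f0 mulmx0 subr0.
  by rewrite gring_ext_op0 => Pe0; case: chi_e; rewrite gring_extE Pe0 mxtrace0.
have WR a : (exists2 b, (b \in R_G)%MS & a = b *m e) -> (a \in R_G)%MS /\
  a *m e = a.
  case=> b Rb ->; split; first exact: envelop_mxM (ciR _ ci_e).
  by rewrite -mulmxA ci_e.2.
exists Phi; split.
- by move=> a b _ _; rewrite -[a]scale1r gring_ext_op_linear rmorph1 !scale1r.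
- by move=> c a _; apply: gring_ext_opZ.
- by move=> a b _ /WR[Rb _]; apply: gring_ext_opM.
- exact: Phi_e.
split=> [a b /WR[Ra ae] /WR[Rb be] Pab|M]; last first.
  have [a Ra <-] := gring_ext_op_onto M; exists (a *m e); first by exists a.
  by rewrite gring_ext_opM ?ciR // Phi_e mulmx1.
apply/eqP; rewrite -subr_eq0; apply/eqP.
(* The difference lies in the kernel, so [f] fixes it; it is also a multiple of [e], and e f = 0. *)
have Rab : (a - b \in R_G)%MS by rewrite linearB addmx_sub ?eqmx_opp.
have fab : f *m (a - b) = a - b.
  by apply: f_id; rewrite gring_ext_opB Pab subrr; split; first exact: Rab.
by rewrite -fab -(ciC _ ci_f _ Rab) -[in LHS]ae -[in LHS]be -mulmxBl -mulmxA
  ef0 mulmx0.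
Qed.

End SplitWedderburnComponent.

(** * Characters over a self-centralizing cyclic normal subgroup *)

(** For g centralizing [K], the group generated by [K] and g is abelian, and normal since it
    contains the derived subgroup; maximality puts g in [K]. *)
Lemma sub_cent_maxnormal_abelian (gT : finGroupType) (G K : {group gT}) :
    [max K | (K <| G) && abelian K] -> G^`(1)%g \subset K ->
  'C_G(K)%g \subset K.
Proof.
case/maxgroupP=> /andP[nsKG abK] maxK sG'K; have sKG := normal_sub nsKG.
apply/subsetP => g /setIP[Gg cKg].
have sKgG : K <*> <[g]> \subset G by rewrite join_subG sKG cycle_subG.
suff defK : K <*> <[g]> = K by rewrite -defK mem_gen // inE cycle_id orbT.
apply: (maxK (K <*> <[g]>)%G); last exact: joing_subl.
rewrite abelianY abK cycle_abelian cycle_subG cKg !andbT.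
by apply: sub_der1_normal sKgG; apply: subset_trans sG'K (joing_subl _ _).
Qed.

Lemma cyclic_quotient_aut_cyclic_pgroup p (gT : finGroupType)
    (G K : {group gT}) :
    odd p -> p.-group K -> cyclic K -> K <| G -> 'C_G(K)%g \subset K ->
  cyclic (G / K)%g.
Proof.
move=> p_odd pK cycK nsKG cGK; have [sKG nKG] := andP nsKG.
have cycA : cyclic (Aut K).
  have [-> | ntK] := eqsVneq K 1%g; first by rewrite Aut1 cyclic1.
  have [m [_ [_ cycF _ _]]] := cyclic_pgroup_Aut_structure pK cycK ntK.
  by rewrite p_odd; case: ifP => [_ -> // | _ [t [_ _ _ [[]]]]].
have kerK : 'ker_G (conj_aut K) = K.
  rewrite ker_conj_aut; apply/eqP; rewrite eqEsubset cGK subsetI sKG.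
  exact: cyclic_abelian.
rewrite -kerK (isog_cyclic (first_isog_loc (conj_aut_morphism K) nKG)).
exact: cyclicS (Aut_conj_aut _ _) cycA.
Qed.

Section LinearCharacterSums.

Variables (E : fieldType) (gT : finGroupType) (K : {group gT}) (a b : gT -> E).
Hypotheses (b1 : b 1%g = 1)
           (aM : {in K &, {morph a : g h / (g * h)%g >-> g * h}})
           (bM : {in K &, {morph b : g h / (g * h)%g >-> g * h}}).

Lemma linchar_inv h : h \in K -> b h * b h^-1%g = 1.
Proof. by move=> Kh; rewrite -bM ?groupV // mulgV. Qed.

Lemma linchar_sum_eq : {in K, a =1 b} ->
  \sum_(h in K) a h * b h^-1%g = #|K|%:R.
Proof.
move=> eq_ab; rewrite (eq_bigr (fun=> 1)) => [|h Kh];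
  first by rewrite sumr_const.
by rewrite eq_ab // linchar_inv.
Qed.

(** Translating the summation variable by [h] gives a(h) S = b(h) S for the sum S. *)
Lemma linchar_sum_neq h : h \in K -> a h != b h ->
  \sum_(h in K) a h * b h^-1%g = 0.
Proof.
move=> Kh ne_ab; apply: (mulfI (_ : b h - a h != 0));
  rewrite ?subr_eq0 1?eq_sym //.
rewrite mulr0 mulrBl; apply/eqP; rewrite subr_eq0; apply/eqP.
rewrite {1}(sum_mulgl _ Kh) !mulr_sumr; apply: eq_bigr => g Kg.
rewrite invMg aM // bM ?groupV // -[RHS]mul1r -(linchar_inv Kh); ring.
Qed.

End LinearCharacterSums.

Section SelfCentralizingCyclic.

Variables (E : fieldType) (gT : finGroupType) (G K : {group gT}) (m : nat).
Variables (rho : mx_representation E G m) (lambda : mx_representation E K 1).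
Hypotheses (E0 : [pchar E] =i pred0) (nsKG : K <| G) (cycK : cyclic K).
Hypotheses (cGK : 'C_G(K)%g \subset K) (sKG : K \subset G).
Hypotheses (irr_rho : mx_irreducible rho) (ff_rho : mx_faithful rho).
Hypothesis rho_lambda : irr_constituent lambda (subg_repr rho sKG).
Local Notation lam := (repr_char lambda).
Local Notation chi := (repr_char rho).

Lemma lin_repr_scalar h : lambda h = (lam h)%:M.
Proof. by rewrite {1}[lambda h]mx11_scalar /repr_char trace_mx11. Qed.

Lemma lin_char1 : lam 1%g = 1.
Proof. by rewrite /repr_char repr_mx1 mxtrace1. Qed.

Lemma lin_charM : {in K &, {morph lam : g h / (g * h)%g >-> g * h}}.
Proof.
move=> g h Kg Kh; rewrite {1}/repr_char repr_mxM // !lin_repr_scalar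
  -scalar_mxM.
by rewrite trace_mx11 mxE eqxx.
Qed.

Lemma lin_charX i : {in K, {morph lam : h / (h ^+ i)%g >-> h ^+ i}}.
Proof.
move=> h Kh; elim: i => [|i IHi]; first by rewrite expr0 expg0 lin_char1.
by rewrite expgS exprS lin_charM ?groupX // IHi.
Qed.

Lemma norm_conj g h : g \in G -> h \in K -> (g * h * g^-1)%g \in K.
Proof.
move=> Gg Kh; have -> : (g * h * g^-1 = h ^ g^-1)%g by rewrite /conjg invgK
  mulgA.
by rewrite memJ_norm // (subsetP (normal_norm nsKG)) ?groupV.
Qed.

Lemma grp_conj_char1 g : grp_conj lam g 1%g = 1.
Proof. by rewrite /grp_conj mulg1 mulgV lin_char1. Qed.

Lemma grp_conj_charM g : g \in G ->
  {in K &, {morph grp_conj lam g : x y / (x * y)%g >-> x * y}}.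
Proof.
move=> Gg x y Kx Ky; rewrite /grp_conj -lin_charM ?norm_conj //.
by rewrite !mulgA mulgKV.
Qed.

(** The one-dimensional submodule is spanned by a common eigenrow of [K], whose translates under [G]
    carry the later computations. *)
Lemma irr_constituent_lin : exists2 v : 'rV[E]_m, v != 0 &
  forall h, h \in K -> v *m rho h = lam h *: v.
Proof.
have [_ [U [modU [B r1 freeB homB]]]] := rho_lambda.
exists (val_submod B) => [|h Kh].
  rewrite val_submod_eq0; apply: contraTneq freeB => ->.
  by rewrite /row_free mxrank0.
rewrite -mul_scalar_mx -lin_repr_scalar -[in LHS](val_submodJ modU) //=
  -homB //.
by rewrite lin_repr_scalar !mul_scalar_mx linearZ.
Qed.

(** By irreducibility the translates of a nonzero row span the whole space. *)
Lemma irr_row_ext (v : 'rV[E]_m) (A1 A2 : 'M[E]_m) : v != 0 ->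
    (forall g, g \in G -> v *m rho g *m A1 = v *m rho g *m A2) -> A1 = A2.
Proof.
move=> v_nz eqA.
have full_v : row_full (cyclic_mx rho v).
  have [_ irr] := (mx_irrP _).1 irr_rho; apply: irr;
    first exact: cyclic_mx_module.
  by rewrite cyclic_mx_eq0.
apply/row_matrixP => i; rewrite !rowE.
have : ((delta_mx 0 i : 'rV_m) <= cyclic_mx rho v)%MS by apply: submx_full.
case/cyclic_mxP=> A /envelop_mxP[a ->] ->.
rewrite mulmx_sumr !mulmx_suml; apply: eq_bigr => g Gg.
by rewrite -!scalemxAr -!scalemxAl eqA.
Qed.

(** The subgroup generated by [h] is characteristic in the cyclic group [K], so [lam] is trivial on
    all conjugates of [h]; thus [h] fixes every translate of the eigenrow, and faithfulness
    applies. *)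
Lemma constituent_char_ker h : h \in K -> lam h = 1 -> h = 1%g.
Proof.
move=> Kh lam_h; have Gh := subsetP sKG h Kh.
have [v v_nz vK] := irr_constituent_lin.
apply/set1P/(subsetP ff_rho)/rkerP; split=> //.
apply: (irr_row_ext v_nz) => g Gg.
have def_gh : (g * h = g * h * g^-1 * g)%g by rewrite mulgKV.
have Kgh := norm_conj Gg Kh; have Ggh := subsetP sKG _ Kgh.
rewrite -mulmxA -repr_mxM // def_gh repr_mxM // mulmxA vK // mulmx1.
have nsh : <[h]> <| G.
  by apply: char_normal_trans nsKG; rewrite sub_cyclic_char // cycle_subG.
have /cycleP[j ->] : (g * h * g^-1 \in <[h]>)%g.
  have -> : (g * h * g^-1 = h ^ g^-1)%g by rewrite /conjg invgK mulgA.
  by rewrite memJ_norm ?cycle_id // (subsetP (normal_norm nsh)) ?groupV.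
by rewrite lin_charX // lam_h expr1n scale1r.
Qed.

Lemma constituent_char_inj : {in K &, injective lam}.
Proof.
move=> g h Kg Kh eq_gh; apply/eqP; rewrite eq_mulgV1;
  apply/eqP/constituent_char_ker.
  by rewrite groupM ?groupV.
by rewrite lin_charM ?groupV // eq_gh -lin_charM ?groupV // mulgV lin_char1.
Qed.

(** As [lam] is injective on [K], equal conjugates mean that [g2^-1 * g1] centralizes [K]. *)
Lemma grp_conj_char_inj g1 g2 : g1 \in G -> g2 \in G ->
  {in K, grp_conj lam g1 =1 grp_conj lam g2} -> (g1 * g2^-1)%g \in K.
Proof.
move=> Gg1 Gg2 eq_lam.
have Kz : (g2^-1 * g1)%g \in K.
  apply: (subsetP cGK); rewrite inE groupM ?groupV //=; apply/centP => h Kh.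
  have := constituent_char_inj (norm_conj Gg1 Kh) (norm_conj Gg2 Kh)
    (eq_lam h Kh).
  move/(congr1 (fun x => g2^-1 * x * g1)%g); rewrite !mulgA mulgKV mulVg mul1g.
  by rewrite /commute !mulgA.
have := norm_conj Gg2 Kz; by rewrite !mulgA mulgV mul1g.
Qed.

Section EigenRow.

Variable v : 'rV[E]_m.
Hypotheses (v_nz : v != 0) (vK : forall h, h \in K -> v *m rho h = lam h *: v).

Lemma eigenrow_conj g h : g \in G -> h \in K ->
  v *m rho g *m rho h = grp_conj lam g h *: (v *m rho g).
Proof.
move=> Gg Kh; have Kgh := norm_conj Gg Kh; have Gh := subsetP sKG h Kh.
rewrite -mulmxA -repr_mxM // -[(g * h)%g](mulgKV g) repr_mxM
  ?(subsetP sKG _ Kgh) //.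
by rewrite mulmxA vK // scalemxAl.
Qed.

Lemma eigenrow_free (I : finType) (x : I -> gT) (u : I -> E) :
    (forall i, x i \in G) -> (forall i j, (x i * (x j)^-1)%g \in K -> i = j) ->
    \sum_i u i *: (v *m rho (x i)) = 0 ->
  forall i, u i = 0.
Proof.
move=> Gx x_inj u0 i.
(* Up to the factor [#|K|], the projection onto the eigenspace of the conjugate of [lam] by [x i];
   it kills the rows with other characters. *)
pose P := \sum_(h in K) grp_conj lam (x i) h^-1%g *: rho h.
have vP j : v *m rho (x j) *m P =
    (\sum_(h in K) grp_conj lam (x j) h * grp_conj lam (x i) h^-1%g) *:
      (v *m rho (x j)).
  rewrite mulmx_sumr scaler_suml; apply: eq_bigr => h Kh.
  by rewrite -scalemxAr eigenrow_conj // scalerA mulrC.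
have := congr1 (mulmx^~ P) u0; rewrite mul0mx mulmx_suml (bigD1 i) //= big1 =>
  [|j ne_ji].
  rewrite addr0 -scalemxAl vP linchar_sum_eq ?grp_conj_char1 //;
    last exact: grp_conj_charM.
  rewrite scalerA => /eqP; rewrite scaler_eq0 => /orP[].
    by rewrite mulf_eq0 (negPf (natf_char0 E0 (cardG_gt0 K))) orbF => /eqP.
  move/eqP=> /(congr1 (mulmx^~ (rho (x i)^-1%g)));
    rewrite repr_mxK // mul0mx => v0.
  by case/eqP: v_nz.
rewrite -scalemxAl vP.
have /existsP[h /andP[Kh neq]] : [exists h in K,
  grp_conj lam (x j) h != grp_conj lam (x i) h].
  apply: contraR ne_ji => /exists_inPn eq_ji; apply/eqP/x_inj.
  by apply: grp_conj_char_inj => // h Kh; apply/eqP;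
    rewrite -[_ == _]negbK eq_ji.
by rewrite (linchar_sum_neq _ _ _ Kh neq) ?scale0r ?scaler0 //;
  [apply: grp_conj_char1 | apply: grp_conj_charM | apply: grp_conj_charM].
Qed.

Lemma coset_rep_in i : @coset_rep gT G K i \in G.
Proof.
have /rcosetsP[g Gg def_i] := enum_valP (i : 'I_#|rcosets K G|).
have : coset_rep i \in K :* coset_rep i by apply: rcoset_refl.
rewrite coset_repP def_i => /rcosetP[h Kh ->].
by rewrite groupM // (subsetP sKG).
Qed.

(** The translates of [v] by coset representatives form an intertwining matrix; its rows are
    independent by [eigenrow_free], and they span a nonzero submodule, hence everything. *)
Lemma eigenrow_induced : mx_rsim (induced_repr G lambda) rho.
Proof.
pose B := \mxcol_(i < #|G : K|) (v *m rho (coset_rep i)).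
have homB g : g \in G -> induced_repr G lambda g *m B = B *m rho g.
  move=> Gg; rewrite mul_mxblock_mxrow mxcol_mul; apply: eq_mxcol => i.
  have [j Kj] := coset_rep_act i Gg.
  rewrite (bigD1 j) //= big1 ?addr0 => [|j' ne_j'j].
    rewrite /induced_block Kj lin_repr_scalar mul_scalar_mx scalemxAl -vK //.
    rewrite -2!mulmxA -!repr_mxM ?(subsetP sKG _ Kj) ?coset_rep_in //.
    by rewrite mulgKV.
  rewrite /induced_block ifN ?mul0mx //; apply: contra ne_j'j => Kj'.
  rewrite -coset_rep_mem -groupV.
  suff -> : ((coset_rep j' * (coset_rep j)^-1)^-1 =
    (coset_rep i * g * (coset_rep j)^-1)^-1
     * (coset_rep i * g * (coset_rep j')^-1))%g by rewrite groupM ?groupV.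
  by rewrite !invMg !invgK !mulgA !mulgKV.
have freeB : row_free B.
  rewrite -kermx_eq0; apply/eqP/row_matrixP => k; rewrite row0.
  have /eqP : row k (kermx B) *m B = 0 by rewrite -row_mul mulmx_ker row0.
  move: (row k _) => u; rewrite -[u]submxrowK mul_mxrow_mxcol => /eqP uB0.
  apply/mxrowP => i; rewrite mxrowK submxrow0.
  apply/matrixP => a b; rewrite !ord1 [RHS]mxE.
  apply: (eigenrow_free (x := @coset_rep gT G K)
    (u := fun i => submxrow u i 0 0)).
  - exact: coset_rep_in.
  - by move=> j j'; rewrite coset_rep_mem => /eqP.
  rewrite -[RHS]uB0; apply: eq_bigr => j _.
  by rewrite [submxrow u j in RHS]mx11_scalar mul_scalar_mx.
have fullB : row_full B.
  have [_ irr] := (mx_irrP _).1 irr_rho.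
  have : row_full <<B>>%MS.
    apply: irr; last first.
      rewrite -mxrank_eq0 genmxE; move: freeB; rewrite /row_free => /eqP->.
      by rewrite sum_nat_const card_ord muln1 -lt0n indexg_gt0.
    apply/mxmoduleP => g Gg; rewrite (eqmxMr _ (genmxE B)) genmxE -homB //.
    exact: submxMl.
  by rewrite -!col_leq_rank genmxE.
exists B => //.
exact: etrans (esym (eqP freeB)) (eqP fullB).
Qed.

End EigenRow.

Lemma irr_induced : mx_rsim rho (induced_repr G lambda).
Proof.
have [v v_nz vK] := irr_constituent_lin.
exact: mx_rsim_sym (eigenrow_induced v_nz vK).
Qed.

Lemma irr_degree_index : m = #|G : K|.
Proof.
by rewrite (mxrank_rsim irr_induced) sum_nat_const card_ord muln1.
Qed.

Lemma grp_conj_charK k g h : k \in K -> g \in G -> h \in K ->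
  grp_conj lam (k * g)%g h = grp_conj lam g h.
Proof.
move=> Kk Gg Kh; rewrite /grp_conj.
have -> : (k * g * h * (k * g)^-1 = k * (g * h * g^-1) * k^-1)%g.
  by rewrite invMg !mulgA.
have Kgh := norm_conj Gg Kh.
rewrite (lin_charM (groupM Kk Kgh) (groupVr Kk)) (lin_charM Kk Kgh) mulrAC.
by rewrite -lin_charM ?groupV // mulgV lin_char1 mul1r.
Qed.

(** The trace yields one conjugate per coset; the factor [#|K|] lets the sum run over [G], free of
    representatives. *)
Lemma irr_char_on_normal h : h \in K ->
  #|K|%:R * chi h = \sum_(g in G) grp_conj lam g h.
Proof.
move=> Kh; rewrite /repr_char (mxtrace_rsim irr_induced) ?(subsetP sKG) //.
rewrite mxtrace_mxblock (set_partition_big _ (rcosets_partition sKG)) /=.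
rewrite [RHS]big_enum_val mulr_sumr; apply: eq_bigr => i _.
rewrite -coset_repP; transitivity (\sum_(k in K) grp_conj lam
  (k * coset_rep i)%g h).
  rewrite (eq_bigr (fun=> grp_conj lam (coset_rep i) h)) => [|k Kk].
    by rewrite sumr_const mulr_natl /induced_block norm_conj ?coset_rep_in.
  by rewrite grp_conj_charK ?coset_rep_in.
by rewrite -rcosetE /rcoset big_imset //= => k1 k2 _ _ /mulIg.
Qed.

Lemma irr_char_off_normal g : g \in G -> g \notin K -> chi g = 0.
Proof.
move=> Gg K'g; rewrite /repr_char (mxtrace_rsim irr_induced) //.
rewrite mxtrace_mxblock big1 // => i _.
rewrite /induced_block ifN ?mxtrace0 //; apply: contra K'g => Ki.
have := norm_conj (groupVr (coset_rep_in i)) Ki.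
by rewrite invgK !mulgA mulVg mul1g mulgKV.
Qed.

End SelfCentralizingCyclic.

(** * Galois conjugates of the linear constituent *)

Section GaloisAction.

Variables (F E : fieldType) (iota : {rmorphism F -> E}).
Variables (gT : finGroupType) (G K : {group gT}) (m : nat).
Variables (rho : mx_representation E G m) (lambda : mx_representation E K 1).
Hypothesis E0 : [pchar E] =i pred0.
Hypothesis algE : forall x : E, algebraicOver iota x.
Hypotheses (nsKG : K <| G) (cycK : cyclic K).
Hypotheses (cGK : 'C_G(K)%g \subset K) (sKG : K \subset G).
Hypotheses (irr_rho : mx_irreducible rho) (ff_rho : mx_faithful rho).
Hypothesis rho_lambda : irr_constituent lambda (subg_repr rho sKG).
Local Notation lam := (repr_char lambda).
Local Notation chi := (repr_char rho).
Local Notation L := (adjoin_field iota (char_values K lam)).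
Local Notation lamL := (fun h => insubd (0 : L) (lam h)).
Local Notation fixF := (is_gal (iota := iota) (S := char_values K lam)
  (fun x => exists a, x = iota a)).
Local Notation gal := (is_gal (iota := iota) (S := char_values K lam)
  (fun x => x \in charfield iota G chi)).

Let Kconj := norm_conj nsKG.

Lemma val_lamL h : h \in K -> val (lamL h) = lam h.
Proof. by move=> Kh; rewrite insubdK //; apply: mem_adjoin; exists h. Qed.

Lemma lamL_span (z : L) :
  exists c : gT -> F, z = \sum_(h in K) adjoin_base iota (char_values K lam)
    (c h) * lamL h.
Proof.
have [c def_z] := charfield_span algE (lin_char1 lambda)
  (@lin_charM _ _ _ lambda) (valP z).
exists c; apply: val_inj; rewrite [LHS]def_z [RHS]rmorph_sum.
by apply: eq_bigr => h Kh; rewrite [RHS]rmorphM; congr (_ * _);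
  apply/esym/val_lamL.
Qed.

Lemma gal_conj1 (tau : {rmorphism L -> L}) : gal_conj tau 1%g = 1.
Proof.
rewrite /gal_conj (_ : insubd _ _ = 1) ?rmorph1 //.
by apply: val_inj; rewrite val_lamL // lin_char1.
Qed.

Lemma gal_conjM (tau : {rmorphism L -> L}) :
  {in K &, {morph gal_conj tau : g h / (g * h)%g >-> g * h}}.
Proof.
move=> g h Kg Kh; rewrite /gal_conj -[RHS]rmorphM -rmorphM; congr (val (tau _)).
apply: val_inj; rewrite val_lamL ?groupM // lin_charM // [RHS]rmorphM.
by congr (_ * _); apply/esym/val_lamL.
Qed.

Lemma gal_ext (tau1 tau2 : {rmorphism L -> L}) : fixF tau1 -> fixF tau2 ->
  {in K, gal_conj tau1 =1 gal_conj tau2} -> tau1 =1 tau2.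
Proof.
move=> [_ fix1] [_ fix2] eq12 z; have [c ->] := lamL_span z.
rewrite !rmorph_sum; apply: eq_bigr => h Kh; rewrite !rmorphM.
rewrite (fix1 (adjoin_base _ _ _)); last by exists (c h).
rewrite (fix2 (adjoin_base _ _ _)); last by exists (c h).
by congr (_ * _); apply: val_inj; apply: eq12.
Qed.

Lemma gal_conj_lamL g (tau : {rmorphism L -> L}) h : g \in G -> h \in K ->
  {in K, grp_conj lam g =1 gal_conj tau} -> tau (lamL h) = lamL
    (g * h * g^-1)%g.
Proof.
move=> Gg Kh eq_g; apply: val_inj; rewrite val_lamL ?Kconj //.
exact: esym (eq_g h Kh).
Qed.

(** With lam^g(h) = lam(g h g^-1) the correspondence between g and tau keeps the order of
    products. *)
Lemma gal_conjM_comp g1 g2 (tau1 tau2 : {rmorphism L -> L}) :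
    g1 \in G -> g2 \in G ->
    {in K, grp_conj lam g1 =1 gal_conj tau1} ->
    {in K, grp_conj lam g2 =1 gal_conj tau2} ->
  {in K, grp_conj lam (g1 * g2)%g =1 gal_conj (tau1 \o tau2)}.
Proof.
move=> Gg1 Gg2 eq1 eq2 h Kh; rewrite /gal_conj /= (gal_conj_lamL Gg2 Kh eq2).
rewrite -[RHS]/(gal_conj tau1 _) -eq1 ?Kconj //.
by rewrite /grp_conj invMg !mulgA.
Qed.

Lemma fixF_comp tau1 tau2 : fixF tau1 -> fixF tau2 -> fixF (tau1 \o tau2).
Proof.
move=> [bij1 fix1] [bij2 fix2]; split; first exact: bij_comp.
by move=> x Fx; rewrite /= fix2 ?fix1.
Qed.

Lemma mem_charfield_F a : iota a \in charfield iota G chi.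
Proof. exact: adjoin_base_subproof. Qed.

Lemma gal_fixF tau : gal tau -> fixF tau.
Proof. by case=> bij fix_chi; split=> // x [a xa]; apply: fix_chi;
  rewrite xa mem_charfield_F. Qed.

Let chi_K := irr_char_on_normal E0 nsKG cycK cGK irr_rho ff_rho rho_lambda.
Let chi_K' := irr_char_off_normal E0 nsKG cycK cGK irr_rho ff_rho rho_lambda.
Let K_nz : #|K|%:R != 0 :> E := natf_char0 E0 (cardG_gt0 K).

Lemma charfield_sub : {subset charfield iota G chi <= charfield iota K lam}.
Proof.
apply: adjoin_sub => [||_ [g Gg ->]]; first exact: adjoin_divring_closed.
  exact: adjoin_base_subproof.
have [Kg | K'g] := boolP (g \in K); last by rewrite chi_K' ?rpred0.
rewrite -[chi g](mulKf K_nz) chi_K // rpredM ?rpredV ?rpred_nat //.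
by apply: rpred_sum => x Gx; apply: mem_adjoin; exists (x * g * x^-1)%g;
  rewrite ?Kconj.
Qed.

(** Up to the factor [#|K|], chi on [K] is the sum of the conjugates of [lam], which [tau] merely
    permutes. *)
Lemma gal_fixes_charfield g (tau : {rmorphism L -> L}) : g \in G -> fixF tau ->
  {in K, grp_conj lam g =1 gal_conj tau} ->
  forall x : L, val x \in charfield iota G chi -> tau x = x.
Proof.
move=> Gg [_ fix_tau] eq_g x chi_x.
pose P := [pred z : E | `[< exists2 v : L, val v = z & tau v = v >]].
suff : val x \in P by case/asboolP=> v /val_inj<-.
move: (val x) chi_x; apply: adjoin_sub => [|a|_ [h Gh ->]].
- exact: fixed_divring_closed.
- apply/asboolP; exists (adjoin_base iota _ a) => //.
  by apply: fix_tau; exists a.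
apply/asboolP; have [Kh | K'h] := boolP (h \in K); last first.
  by exists 0; rewrite ?rmorph0 // chi_K'.
exists (#|K|%:R^-1 * \sum_(x in G) lamL (x * h * x^-1)%g).
  apply: (mulfI K_nz); rewrite chi_K // [val _]rmorphM fmorphV
    [X in X^-1]rmorph_nat mulVKf //.
  rewrite [LHS]rmorph_sum; apply: eq_bigr => x' Gx'.
  by apply: val_lamL; apply: Kconj.
rewrite rmorphM fmorphV rmorph_nat rmorph_sum; congr (_ * _).
rewrite [RHS](sum_mulgl _ Gg); apply: eq_bigr => x' Gx'.
rewrite (gal_conj_lamL Gg _ eq_g) ?Kconj //.
by rewrite invMg !mulgA.
Qed.

(* Evaluate sum_h chi(h) lambda^tau(h^-1) in two ways: expanding chi as it
   stands it vanishes unless lambda^tau is some lambda^g; expanding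
   chi = chi^tau it is a positive integer. *)
Lemma gal_from_charfield (tau : {rmorphism L -> L}) : gal tau ->
  exists2 g, g \in G & {in K, grp_conj lam g =1 gal_conj tau}.
Proof.
move=> [_ fix_tau]; pose mu := gal_conj tau.
have sum_conj h : h \in K ->
    \sum_(x in G) grp_conj lam x h = \sum_(x in G) mu (x * h * x^-1)%g.
  move=> Kh; pose z : L := \sum_(x in G) lamL (x * h * x^-1)%g.
  have val_z : val z = \sum_(x in G) grp_conj lam x h.
    rewrite [LHS]rmorph_sum; apply: eq_bigr => x Gx.
    by apply: val_lamL; apply: Kconj.
  rewrite -val_z -(fix_tau z); first by rewrite rmorph_sum [LHS]rmorph_sum.
  rewrite val_z -chi_K // rpredM ?rpred_nat //; apply: mem_adjoin.
  by exists h; rewrite ?(subsetP sKG).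
have mu_conjM x : x \in G ->
    {in K &, {morph (fun h => mu (x * h * x^-1)%g) : g h / (g * h)%g >->
      g * h}}.
  move=> Gx g h Kg Kh; rewrite -gal_conjM ?Kconj //.
  by rewrite !mulgA mulgKV.
have [/existsP[x /andP[Gx /forall_inP eq_x]] | /exists_inPn no_x] :=
    boolP [exists x in G, [forall h in K, grp_conj lam x h == mu h]].
  by exists x => // h Kh; apply/eqP/eq_x.
pose b x := [forall h in K, mu (x * h * x^-1)%g == mu h].
(* Each x contributes [#|K|] or 0 according to whether conjugation by x fixes [mu]; x = 1
   contributes [#|K|], so the sum is a positive integer in characteristic 0. *)
have T_nz : \sum_(x in G) \sum_(h in K) mu (x * h * x^-1)%g * mu h^-1%g != 0.
  rewrite (eq_bigr (fun x => (b x * #|K|)%:R)) => [|x Gx].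
    rewrite -natr_sum natf_char0 // (bigD1 1%g) //= addn_gt0 muln_gt0 cardG_gt0
      andbT.
    by rewrite lt0b; apply/orP; left; apply/forall_inP => h _;
      rewrite mul1g invg1 mulg1.
  case: (boolP (b x)) => [/forall_inP eq_x | ].
    rewrite mul1n; apply: (linchar_sum_eq (gal_conj1 tau) (gal_conjM tau)) =>
      h Kh.
    exact/eqP/eq_x.
  rewrite negb_forall_in mul0n => /existsP[h /andP[Kh neq_h]].
  by rewrite (linchar_sum_neq (gal_conj1 tau) (mu_conjM x Gx) (gal_conjM tau)
    Kh neq_h).
case/eqP: T_nz; rewrite exchange_big /=.
rewrite (eq_bigr (fun h => \sum_(x in G) grp_conj lam x h * mu h^-1%g)) =>
  [|h Kh].
  rewrite exchange_big /=; apply: big1 => x Gx.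
  have := no_x x Gx; rewrite negb_forall_in => /existsP[h /andP[Kh neq_h]].
  exact: (linchar_sum_neq (gal_conj1 tau) (grp_conj_charM lambda nsKG Gx)
    (gal_conjM tau) Kh neq_h).
by rewrite -!mulr_suml sum_conj.
Qed.

(** Lets the definition of I, stated with automorphisms over F, be read with those over F(chi). *)
Lemma gal_iff_fixF g (tau : {rmorphism L -> L}) : g \in G ->
  {in K, grp_conj lam g =1 gal_conj tau} -> fixF tau <-> gal tau.
Proof.
move=> Gg eq_g; split=> [fixF_tau|]; last exact: gal_fixF.
by split; [case: fixF_tau | apply: gal_fixes_charfield Gg fixF_tau eq_g].
Qed.

Local Notation I := (gal_stabilizer iota K lam G).

Lemma gal_stabilizerP g : reflect
  (g \in G /\ exists2 tau, gal tau & {in K, grp_conj lam g =1 gal_conj tau})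
    (g \in I).
Proof.
rewrite inE; apply: (iffP andP) => -[Gg].
  case/asboolP=> tau fix_tau eq_g; split=> //; exists tau => //.
  exact/(gal_iff_fixF Gg eq_g).
case=> tau fix_tau eq_g; split=> //; apply/asboolP; exists tau => //.
exact/(gal_iff_fixF Gg eq_g).
Qed.

Lemma gal_stabilizer_group_set : group_set I.
Proof.
apply/group_setP; split=> [|g1 g2 /gal_stabilizerP[Gg1 [tau1 gal1 eq1]]
  /gal_stabilizerP[Gg2 [tau2 gal2 eq2]]].
  apply/gal_stabilizerP; split=> //; exists idfun; first by split;
    first by exists id.
  by move=> h Kh; rewrite /grp_conj mul1g invg1 mulg1 /gal_conj [val _]val_lamL.
apply/gal_stabilizerP; split; first exact: groupM.
exists (tau1 \o tau2); last exact: gal_conjM_comp.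
case: gal1 gal2 => bij1 fix1 [bij2 fix2]; split; first exact: bij_comp.
by move=> x chi_x; rewrite /= fix2 ?fix1.
Qed.

Lemma gal_stabilizer_cyclic : cyclic (G / K)%g -> cyclic (I / K)%g.
Proof.
pose J := Group gal_stabilizer_group_set.
by apply: (@cyclicS _ _ (J / K)%G); apply/quotientS/subsetP =>
  g /gal_stabilizerP[].
Qed.

(** Conjugation by [K] fixes [lam], so tau depends only on the coset. Injectivity comes from
    [grp_conj_char_inj], surjectivity from [gal_from_charfield]. *)
Lemma gal_stabilizer_isom : @isom_gal F E iota (char_values K lam) _ (I / K)%g
  (fun x => x \in charfield iota G chi).
Proof.
pose R u (tau : {rmorphism L -> L}) := u \in (I / K)%g -> gal tau /\
  forall g, g \in G -> coset K g = u -> {in K, grp_conj lam g =1 gal_conj tau}.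
have /choice[f fP] : forall u, exists tau, R u tau.
  move=> u; have [/morphimP[g Ng Ig def_u] | I'u] := boolP (u \in (I / K)%g);
    last first.
    by exists idfun => /(negP I'u).
  have [Gg [tau gal_tau eq_g]] := gal_stabilizerP _ Ig.
  exists tau => _; split=> // g' Gg' def_u' h Kh; rewrite -eq_g //.
  have [k Kk ->] : exists2 k, k \in K & g' = (k * g)%g.
    by apply: kercoset_rcoset; rewrite ?(subsetP (normal_norm nsKG)) // def_u'.
  by rewrite (grp_conj_charK _ nsKG).
have repr_I u : u \in (I / K)%g -> exists2 g, g \in G & coset K g = u.
  by case/morphimP=> g _ /gal_stabilizerP[Gg _] ->; exists g.
have NG := subsetP (normal_norm nsKG).
exists f; split=> [u /fP[] //|u1 u2 Iu1 Iu2|u1 u2 Iu1 Iu2 eq_f|tau gal_tau].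
- have [[gal1 eq1] [gal2 eq2]] := (fP _ Iu1, fP _ Iu2).
  have [[g1 Gg1 def1] [g2 Gg2 def2]] := (repr_I _ Iu1, repr_I _ Iu2).
  have Iu12 : (u1 * u2)%g \in (I / K)%g.
    by rewrite -[I]/(gval (Group gal_stabilizer_group_set)) groupM.
  have [gal12 eq12] := fP _ Iu12.
  apply: (gal_ext (gal_fixF gal12) (fixF_comp (gal_fixF gal1) (gal_fixF gal2)))
    => h Kh.
  rewrite -(eq12 (g1 * g2)%g) ?groupM //;
    last by rewrite morphM ?NG //= def1 def2.
  by rewrite (gal_conjM_comp Gg1 Gg2 (eq1 _ Gg1 def1) (eq2 _ Gg2 def2)).
- have [[_ eq1] [_ eq2]] := (fP _ Iu1, fP _ Iu2).
  have [[g1 Gg1 def1] [g2 Gg2 def2]] := (repr_I _ Iu1, repr_I _ Iu2).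
  rewrite -def1 -def2; apply/(rcoset_kercosetP (NG _ Gg1) (NG _ Gg2)).
  rewrite mem_rcoset; apply: (grp_conj_char_inj nsKG cycK cGK irr_rho ff_rho
    rho_lambda) => // h Kh.
  by rewrite (eq1 _ Gg1 def1) // (eq2 _ Gg2 def2) // /gal_conj eq_f.
have [g Gg eq_g] := gal_from_charfield gal_tau.
have Ig : g \in I by apply/gal_stabilizerP; split=> //; exists tau.
have Iu : coset K g \in (I / K)%g by apply: (mem_quotient K
  (_ : g \in Group gal_stabilizer_group_set)).
exists (coset K g) => //; have [gal_f eq_f] := fP _ Iu.
apply: (gal_ext (gal_fixF gal_f) (gal_fixF gal_tau)) => h Kh.
by rewrite -(eq_f g) // eq_g.
Qed.

(* Averaging over y turns lambda^y into chi, so the fixed field of tau is F(chi)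
   without appeal to the Galois correspondence. *)
Lemma fixed_conj_span g (tau : {rmorphism L -> L}) (z : L) :
    g \in G -> fixF tau ->
    (G / K)%g = <[coset K g]>%g -> {in K, grp_conj lam g =1 gal_conj tau} ->
    tau z = z ->
  exists c : gT -> F, forall y, y \in G ->
    val z = \sum_(h in K) iota (c h) * grp_conj lam y h.
Proof.
move=> Gg [_ fix_tau] defGK eq_g fix_z; have [c def_z] := lamL_span z.
(* Applying [tau] i times leaves [z] unchanged and turns [lam] into its conjugate by [g ^+ i] in the
   expansion. *)
have fix_pow i : val z = \sum_(h in K) iota (c h) * grp_conj lam (g ^+ i)%g h.
  have -> : val z = val (iter i tau z).
    by congr val; elim: i => //= i <-.
  rewrite [in LHS]def_z.
  have -> : iter i tau (\sum_(h in K) adjoin_base iota (char_values K lam)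
    (c h) * lamL h) =
      \sum_(h in K) adjoin_base iota (char_values K lam) (c h) * lamL
        (g ^+ i * h * g ^- i)%g.
    elim: i => [|i /= ->].
      by apply: eq_bigr => h _; rewrite expg0 invg1 mul1g mulg1.
    rewrite rmorph_sum; apply: eq_bigr => h Kh; rewrite rmorphM fix_tau;
      last by exists (c h).
    rewrite (gal_conj_lamL Gg _ eq_g) ?Kconj ?groupX //.
    by rewrite expgS invMg !mulgA.
  rewrite [LHS]rmorph_sum; apply: eq_bigr => h Kh; rewrite [LHS]rmorphM.
  by congr (_ * _); apply: val_lamL; rewrite Kconj ?groupX.
exists c => y Gy; have : coset K y \in (G / K)%g by apply: mem_quotient.
rewrite defGK => /cycleP[i]; rewrite -morphX
  ?(subsetP (normal_norm nsKG)) // => def_y.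
have [k Kk ->] : exists2 k, k \in K & y = (k * g ^+ i)%g.
  by apply: kercoset_rcoset; rewrite ?groupX ?(subsetP (normal_norm nsKG)).
rewrite (fix_pow i); apply: eq_bigr => h Kh.
by rewrite (grp_conj_charK _ nsKG) ?groupX.
Qed.

Lemma charfield_fixed g (tau : {rmorphism L -> L}) : g \in G -> gal tau ->
    (G / K)%g = <[coset K g]>%g -> {in K, grp_conj lam g =1 gal_conj tau} ->
  forall x : E, x \in charfield iota G chi <-> exists2 z : L,
    val z = x & tau z = z.
Proof.
move=> Gg gal_tau defGK eq_g x; split=> [chi_x | [z <- fix_z]].
  exists (AdjoinField (charfield_sub chi_x)) => //.
  by case: gal_tau => _; apply.
have [c fix_all] := fixed_conj_span Gg (gal_fixF gal_tau) defGK eq_g fix_z.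
have G_nz : #|G|%:R != 0 :> E := natf_char0 E0 (cardG_gt0 G).
rewrite -[val z](mulKf G_nz) rpredM ?rpredV ?rpred_nat //.
(* Summing the expansions over [G] turns the conjugates of [lam] at h into [#|K|%:R * chi h]. *)
have -> : #|G|%:R * val z = \sum_(y in G) \sum_(h in K) iota (c h) * grp_conj
  lam y h.
  by rewrite -(eq_bigr _ fix_all) sumr_const mulr_natl.
rewrite exchange_big; apply: rpred_sum => h Kh.
rewrite -mulr_sumr -chi_K // rpredM ?mem_charfield_F // rpredM ?rpred_nat //.
by apply: mem_adjoin; exists h; rewrite ?(subsetP sKG).
Qed.

End GaloisAction.

(** * A form of the representation over its character field *)

Lemma charfield_poly (F E : fieldType) (iota : {rmorphism F -> E})
    (S : E -> Prop)
    (Q : {poly E}) : (forall i, Q`_i \in adjoin iota S) ->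
  exists Qk : {poly adjoin_field iota S},
    map_poly (@adjoin_val F E iota S) Qk = Q.
Proof.
move=> kQ; exists (\poly_(i < size Q) insubd 0 Q`_i); apply/polyP => i.
rewrite coef_map coef_poly; case: ltnP => [_ | /leq_sizeP-> //].
exact: insubdK (kQ i).
Qed.

Section RationalForm.

Variables (F : fieldType) (E : closedFieldType) (iota : {rmorphism F -> E}).
Variables (gT : finGroupType) (G K : {group gT}) (m : nat).
Variables (rho : mx_representation E G m) (lambda : mx_representation E K 1).
Hypothesis F0 : [pchar F] =i pred0.
Hypothesis algE : forall x : E, algebraicOver iota x.
Hypotheses (nsKG : K <| G) (cycK : cyclic K).
Hypotheses (cGK : 'C_G(K)%g \subset K) (sKG : K \subset G).
Hypotheses (irr_rho : mx_irreducible rho) (ff_rho : mx_faithful rho).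
Hypothesis rho_lambda : irr_constituent lambda (subg_repr rho sKG).
Local Notation lam := (repr_char lambda).
Local Notation chi := (repr_char rho).
Local Notation L := (adjoin_field iota (char_values K lam)).
Local Notation k := (adjoin_field iota (char_values G chi)).
Local Notation valk := (@adjoin_val F E iota (char_values G chi)).
Local Notation lamL := (fun h => insubd (0 : L) (lam h)).

Variables (y : gT) (tau : {rmorphism L -> L}).
Local Notation d := #[coset K y]%g.
Hypotheses (Gy : y \in G) (defGK : (G / K)%g = <[coset K y]>%g).
Hypothesis yd1 : (y ^+ d)%g = 1%g.
Hypotheses (gal_tau : is_gal (fun x => x \in charfield iota G chi) tau).
Hypothesis tau_y : {in K, grp_conj lam y =1 gal_conj tau}.

Let E0 : [pchar E] =i pred0.
Proof. by move=> q; rewrite -F0 -(fmorph_pchar iota). Qed.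

Let K_conj := norm_conj nsKG.
Let Gyi i : (y ^+ i)%g \in G := groupX i Gy.
Let NG := subsetP (normal_norm nsKG).

Lemma degree_cyclic_quotient : m = d.
Proof.
rewrite (irr_degree_index E0 nsKG cycK cGK irr_rho ff_rho rho_lambda).
by rewrite -card_quotient ?normal_norm // defGK.
Qed.

Lemma ord_coset_inj (i j : 'I_d) : (y ^+ i * (y ^+ j)^-1)%g \in K -> i = j.
Proof.
rewrite -mem_rcoset => /(rcoset_kercosetP (NG (Gyi i)) (NG (Gyi j))).
rewrite !morphX ?NG // => /eqP; rewrite eq_expg_mod_order !modn_small //.
by move/eqP/val_inj.
Qed.

Lemma grp_conj_charX g h n : g \in G -> h \in K ->
  grp_conj lam g (h ^+ n)%g = grp_conj lam g h ^+ n.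
Proof.
move=> Gg Kh; elim: n => [|n IHn]; first by rewrite expg0 expr0 grp_conj_char1.
by rewrite expgS exprS (grp_conj_charM _ nsKG) ?groupX // IHn.
Qed.

Section Basis.

Variables (v : 'rV[E]_m) (x : gT).
Hypotheses (v_nz : v != 0) (vK : forall h, h \in K -> v *m rho h = lam h *: v).
Hypothesis defK : K = <[x]>%g :> {set gT}.

Let Kx : x \in K. Proof. by rewrite defK cycle_id. Qed.
Let K_gen h : h \in K -> exists n, h = (x ^+ n)%g.
Proof. by rewrite defK => /cycleP. Qed.
Let Gx i : (x ^+ i)%g \in G. Proof. by rewrite groupX // (subsetP sKG). Qed.

(* Since y^d = 1, the vector w = sum_j v rho(y^j) is fixed by y, and
   w rho(h) = sum_j sigma^j(lambda(h)) v rho(y^j): the F(chi)-span of the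
   translates of w is a copy of F(lambda), with F(chi)-basis w rho(x^i), i < d,
   on which K acts by multiplication and y by sigma. *)
Definition fixed_row := \sum_(j < d) v *m rho (y ^+ j)%g.
Local Notation w := fixed_row.
Local Notation zeta := (fun j => grp_conj lam (y ^+ j)%g x).

Definition fixed_basis : 'M[E]_(d, m) := \matrix_(i < d) (w *m rho (x ^+ i)%g).
Local Notation B := fixed_basis.

(** Multiplication by [rho y] shifts the summands, and the last wraps around to the first because
    [y ^+ d = 1]; this is what the splitting provides. *)
Lemma fixed_rowX i : w *m rho (y ^+ i)%g = w.
Proof.
elim: i => [|i IHi]; first by rewrite expg0 repr_mx1 mulmx1.
rewrite expgSr repr_mxM // mulmxA IHi /w mulmx_suml.
rewrite -(@big_ord_shift _ _ _ _ (fun j => v *m rho (y ^+ j)%g)) ?yd1 //.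
by apply: eq_bigr => j _; rewrite -mulmxA -repr_mxM // -expgSr.
Qed.

Lemma fixed_row_conj h : h \in K ->
  w *m rho h = \sum_(j < d) grp_conj lam (y ^+ j)%g h *: (v *m rho (y ^+ j)%g).
Proof.
move=> Kh; rewrite mulmx_suml; apply: eq_bigr => j _.
exact: (eigenrow_conj nsKG sKG vK).
Qed.

Lemma conj_generator_inj : injective (fun j : 'I_d => zeta j).
Proof.
move=> i j /= eq_ij; apply: ord_coset_inj.
apply: (grp_conj_char_inj nsKG cycK cGK irr_rho ff_rho rho_lambda) => // h.
by move/K_gen=> [n ->]; rewrite !grp_conj_charX // eq_ij.
Qed.

(** A linear relation among the rows is a polynomial of degree below d with the d distinct roots
    [zeta j]. *)
Lemma fixed_basis_free : row_free B.
Proof.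
rewrite -kermx_eq0; apply/eqP/row_matrixP => l; rewrite row0.
have : row l (kermx B) *m B = 0 by rewrite -row_mul mulmx_ker row0.
move: (row l _) => u uB0.
pose q := \poly_(i < d) (if insub i is Some i' then u 0 i' else 0 : E).
have q_i (i : 'I_d) : q`_i = u 0 i by rewrite coef_poly ltn_ord valK.
have q_zeta (j : 'I_d) : root q (zeta j).
  apply/eqP; move: j; apply: (eigenrow_free E0 nsKG cycK cGK irr_rho ff_rho
    rho_lambda v_nz vK (x := fun j : 'I_d => (y ^+ j)%g)) => //.
    exact: ord_coset_inj.
  rewrite -[RHS]uB0 mulmx_sum_row.
  rewrite (eq_bigr (fun j : 'I_d => \sum_(i < d) (u 0 i * zeta j ^+ i) *:
    (v *m rho (y ^+ j)%g))).
    rewrite exchange_big; apply: eq_bigr => i _.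
    rewrite rowK fixed_row_conj ?groupX // scaler_sumr; apply: eq_bigr => j _.
    by rewrite grp_conj_charX // scalerA.
  move=> j _; rewrite -scaler_suml (horner_coef_wide _ (size_poly _ _)).
  by congr (_ *: _); apply: eq_bigr => i _; rewrite q_i.
have q0 : q = 0.
  apply: contraTeq (size_poly d (fun i =>
    if insub i is Some i' then u 0 (i' : 'I_d) else 0)) => q_nz.
  rewrite -ltnNge; have := max_poly_roots (rs := [seq zeta j | j : 'I_d]) q_nz.
  rewrite size_image card_ord; apply; last by rewrite map_inj_uniq
    ?enum_uniq //; apply: conj_generator_inj.
  by apply/allP => _ /imageP[j _ ->].
by apply/rowP => i; rewrite mxE -q_i q0 coef0.
Qed.

(* Q is the minimal polynomial of lambda(x) over F(chi); its coefficients lie in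
   F(chi) because sigma permutes its roots. *)
Lemma conj_generator_poly :
  exists2 Q : {poly k}, size Q = d.+1 & forall j : 'I_d,
    root (map_poly valk Q) (zeta j).
Proof.
pose z j : L := lamL (y ^+ j * x * y ^- j)%g.
have val_z j : val (z j) = zeta j by apply: val_lamL; apply: K_conj.
have tau_z j : tau (z j) = z j.+1.
  rewrite /z (gal_conj_lamL nsKG Gy (K_conj (Gyi j) Kx) tau_y).
  by congr (insubd _ (lam _)); rewrite expgS invMg !mulgA.
have zd : z d = z 0 by rewrite /z yd1 expg0.
pose QL : {poly L} := \prod_(j < d) ('X - (z j)%:P).
pose Q := map_poly (@adjoin_val F E iota (char_values K lam)) QL.
have defQ : Q = \prod_(j < d) ('X - (zeta j)%:P).
  rewrite /Q /QL map_prod_XsubC; apply: eq_bigr => j _.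
  by congr ('X - _%:P); apply: val_z.
have tauQ : map_poly tau QL = QL by apply: map_cyclic_prod_XsubC.
have kQ i : Q`_i \in charfield iota G chi.
  apply/(charfield_fixed E0 algE nsKG cycK cGK irr_rho ff_rho rho_lambda Gy
    gal_tau defGK tau_y).
  by exists QL`_i; rewrite ?coef_map // -[in RHS]tauQ coef_map.
have [Qk defQk] := charfield_poly kQ.
exists Qk => [|j].
  rewrite -(size_map_poly (valk : {rmorphism k -> E})) /= defQk defQ.
  rewrite -(big_enum _ _ predT (fun j : 'I_d => 'X - (zeta j)%:P))
    size_prod_XsubC.
  by rewrite -cardE card_ord.
by rewrite defQk defQ (bigD1 j) //= rootM root_XsubC eqxx.
Qed.

(** Write g as a power of [y] times some x^n. The power of [y] fixes [w], and the coordinates of w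
    rho(x^n) are the coefficients of X^n modulo Q, which agrees with X^n at every [zeta j]. *)
Lemma fixed_row_span g : g \in G ->
  exists r : 'rV[k]_d, w *m rho g = map_mx valk r *m B.
Proof.
move=> Gg; have : coset K g \in (G / K)%g by apply: mem_quotient.
rewrite defGK => /cycleP[a]; rewrite -morphX ?NG // => def_g.
have [z Kz ->] : exists2 z, z \in K & g = (z * y ^+ a)%g.
  by apply: kercoset_rcoset; rewrite ?NG.
have Kzy : (z ^ (y ^+ a))%g \in K by rewrite memJ_norm // NG.
rewrite conjgC repr_mxM ?(subsetP sKG _ Kzy) // mulmxA fixed_rowX.
have [n ->] := K_gen Kzy.
have [Q sizeQ rootQ] := conj_generator_poly.
pose r := ('X^n %% Q)%R.
have Q_nz : Q != 0 by rewrite -size_poly_gt0 sizeQ.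
have size_r : (size r <= d)%N by rewrite -ltnS -sizeQ ltn_modp.
exists (\row_i r`_i); rewrite fixed_row_conj ?groupX // mulmx_sum_row.
rewrite (eq_bigr (fun j : 'I_d => \sum_(i < d) (valk r`_i * zeta j ^+ i) *:
  (v *m rho (y ^+ j)%g))).
  rewrite exchange_big; apply: eq_bigr => i _.
  rewrite !mxE rowK fixed_row_conj ?groupX // scaler_sumr;
    apply: eq_bigr => j _.
  by rewrite grp_conj_charX // scalerA.
move=> j _; rewrite -scaler_suml grp_conj_charX //; congr (_ *: _).
have size_r' : (size (map_poly valk r) <= d)%N by rewrite size_map_poly.
transitivity (map_poly valk r).[zeta j]; last first.
  rewrite (horner_coef_wide _ size_r'); apply: eq_bigr => i _.
  by rewrite coef_map.
have := divp_eq ('X^n : {poly k}) Q; rewrite -/r =>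
  /(congr1 (fun p => (map_poly valk p).[zeta j])).
rewrite map_polyXn hornerXn rmorphD rmorphM /= hornerD hornerM => ->.
by rewrite (eqP (rootQ j)) mulr0 add0r.
Qed.

End Basis.

(** [g] sends w rho(x^i) to w rho(x^i g), whose coordinates lie in k; freeness of the basis makes
    these matrices unique, hence multiplicative. *)
Lemma rational_form : exists rk : mx_representation k G d,
  exists2 B : 'M[E]_(d, m), row_free B &
    forall g, g \in G -> map_mx valk (rk g) *m B = B *m rho g.
Proof.
have [v v_nz vK] := irr_constituent_lin rho_lambda.
have [x defK] := cyclicP cycK; have Kx : x \in K by rewrite defK cycle_id.
have Gx i : (x ^+ i)%g \in G by rewrite groupX // (subsetP sKG).
pose B := fixed_basis v x; have freeB : row_free B :=
  fixed_basis_free v_nz vK defK.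
have /choice[r rP] : forall g, exists r : 'rV[k]_d,
    g \in G -> fixed_row v *m rho g = map_mx valk r *m B.
  move=> g; have [Gg | G'g] := boolP (g \in G); last by exists 0.
  by have [r def_r] := fixed_row_span vK defK Gg; exists r.
pose M g : 'M[k]_d := \matrix_(i < d) r (x ^+ i * g)%g.
have MB g : g \in G -> map_mx valk (M g) *m B = B *m rho g.
  move=> Gg; apply/row_matrixP => i; rewrite !row_mul !rowK -map_row rowK.
  by rewrite -rP ?groupM // repr_mxM // mulmxA.
have injM (A1 A2 : 'M[k]_d) : map_mx valk A1 *m B = map_mx valk A2 *m B -> A1 =
  A2.
  by move/(row_free_inj freeB)/map_mx_inj.
have reprM : mx_repr G M.
  split=> [|g h Gg Gh]; apply: injM.
    by rewrite MB // repr_mx1 mulmx1 map_mx1 mul1mx.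
  by rewrite MB ?groupM // map_mxM -mulmxA MB // mulmxA MB // -mulmxA repr_mxM.
by exists (MxRepresentation reprM), B.
Qed.

Lemma wedderburn_component_matrix : wedderburn_isom_matrix iota G chi
    (char_values G chi) d.
Proof.
have [rk [B freeB rkB]] := rational_form.
have sim_rk : mx_rsim (map_repr (valk : {rmorphism k -> E}) rk) rho.
  by exists B; rewrite // -degree_cyclic_quotient.
apply: (split_wedderburn_component (rk := rk)) => // [g Gg||c].
- rewrite /repr_char -(mxtrace_rsim sim_rk) //= /map_repr_mx.
  exact: trace_map_mx.
- rewrite -(map_mx_abs_irr (valk : {rmorphism k -> E}))
    (mx_rsim_abs_irr sim_rk).
  exact: group_closure_closed_field irr_rho.
(* An element c of F(chi) is fixed by [tau], so a single family [a] over F expresses c through every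
   conjugate of [lam]; the sum of the a(h) rho(h) then acts as c on each translate of [v]. *)
have [z val_z fix_z] := (charfield_fixed E0 algE nsKG cycK cGK irr_rho ff_rho
  rho_lambda Gy gal_tau defGK tau_y (val c)).1 (valP c).
have [a def_z] := fixed_conj_span algE nsKG Gy (gal_fixF gal_tau) defGK tau_y
  fix_z.
have [v v_nz vK] := irr_constituent_lin rho_lambda.
exists (fun h => if h \in K then a h else 0).
suff eqB : map_mx valk c%:M *m B =
    map_mx valk (\sum_(h in G) adjoin_base iota (char_values G chi)
      (if h \in K then a h else 0) *: rk h) *m B.
  exact: map_mx_inj (row_free_inj freeB eqB).
rewrite map_scalar_mx mul_scalar_mx -mul_mx_scalar map_mx_sum mulmx_suml.
rewrite (eq_bigr (fun h => B *m (iota (if h \in K then a h else 0) *: rho h)))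
  => [|h Gh]; last first.
  by rewrite map_mxZ -scalemxAl rkB // scalemxAr.
rewrite -mulmx_sumr; congr (_ *m _); apply: (irr_row_ext irr_rho v_nz) => g Gg.
have def_c : valk c = _ := etrans (esym val_z) (def_z g Gg).
rewrite mul_mx_scalar /= def_c mulmx_sumr scaler_suml [RHS](big_setID K) /=.
rewrite (setIidPr sKG) [X in _ + X]big1 ?addr0 => [|h /setDP[_ /negPf->]];
  last first.
  by rewrite rmorph0 scale0r mulmx0.
apply: eq_bigr => h Kh; rewrite Kh -scalemxAr.
by rewrite (eigenrow_conj nsKG sKG vK) // scalerA.
Qed.

End RationalForm.

(** * F(lambda) as a cyclotomic extension, and the two parts of the theorem *)

Lemma charfield_prim_root (F E : fieldType) (iota : {rmorphism F -> E})
    (gT : finGroupType) (K : {group gT}) (lambda : mx_representation E K 1)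
    (zeta : E) :
    cyclic K -> {in K &, injective (repr_char lambda)} ->
    #|K|.-primitive_root zeta ->
  charfield iota K (repr_char lambda) =i adjoin iota (fun x => x = zeta).
Proof.
case/cyclicP=> x defK constituent_char_inj prim_zeta.
have Kx : x \in K by rewrite defK cycle_id.
(* Injectivity of the character gives its value at the generator the exact order [#|K|]. *)
have prim_x : #|K|.-primitive_root (repr_char lambda x).
  have x1 : repr_char lambda x ^+ #|K| = 1 by rewrite -lin_charX //
    expg_cardG // lin_char1.
  have [m prim_m dv_m] := prim_order_exists (cardG_gt0 K) x1.
  suff -> : #|K| = m by [].
  apply/eqP; rewrite eqn_dvd dv_m andbT defK -[#|_|]/#[x]%g order_dvdn.
  apply/eqP/constituent_char_inj; rewrite ?groupX //.
  by rewrite lin_charX // prim_expr_order // lin_char1.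
have zeta_in : zeta \in charfield iota K (repr_char lambda).
  have [i ->] := prim_rootP prim_x (prim_expr_order prim_zeta).
  by rewrite -lin_charX //; apply: mem_adjoin; exists (x ^+ i)%g;
    rewrite ?groupX.
move=> z; apply/idP/idP; move: z; apply: adjoin_sub => [||s].
- exact: adjoin_divring_closed.
- exact: adjoin_base_subproof.
- case=> h Kh ->.
  have h1 : repr_char lambda h ^+ #|K| = 1 by rewrite -lin_charX //
    expg_cardG // lin_char1.
  have [i ->] := prim_rootP prim_zeta h1.
  by rewrite rpredX //; apply: mem_adjoin.
- exact: adjoin_divring_closed.
- exact: adjoin_base_subproof.
by move->.
Qed.

Theorem theorem7p0p1
    (p n : nat) (F : fieldType) (Fbar : closedFieldType)
    (iota : {rmorphism F -> Fbar}) (gT : finGroupType) (G K : {group gT})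
    (m : nat) (rho : mx_representation Fbar G m)
    (lambda : mx_representation Fbar K 1)
    (hp : prime p) (hp_odd : odd p) (hn : (0 < n)%N)
    (hF : [pchar F] =i pred0)
    (hFbar : forall x : Fbar, algebraicOver iota x)
    (hGmetabelian : abelian G^`(1)%g)
    (hKmax : [max K | (K <| G) && abelian K])
    (hKcyc : cyclic K) (hKcard : #|K| = (p ^ n)%N)
    (hG'K : G^`(1)%g \subset K) (hKG : K \subset G)
    (hrho_irr : mx_irreducible rho) (hrho_faithful : mx_faithful rho)
    (hlambda : irr_constituent lambda (subg_repr rho hKG)) :
  let chi : gT -> Fbar := repr_char rho in
  let lam : gT -> Fbar := repr_char lambda in
  let Fchi : {pred Fbar} := charfield iota G chi in
  let Flam : {pred Fbar} := charfield iota K lam in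
  let I : {set gT} := gal_stabilizer iota K lam G in
  (* part (1) *)
  [/\ mx_rsim rho (induced_repr G lambda),
      forall zeta : Fbar, ((p ^ n)%N).-primitive_root zeta ->
        Flam =i adjoin iota (fun x => x = zeta),
      {subset Fchi <= Flam},
      @isom_gal F Fbar iota (char_values K lam) _ (I / K)%g
        (fun x => x \in Fchi) &
      cyclic (I / K)%g]
  /\
  (* part (2) *)
  (I = G ->
   forall (y : gT) (d : nat), y \in G ->
     (G / K)%g = <[coset K y]>%g -> #[coset K y]%g = d ->
   exists sigma : {rmorphism adjoin_field iota (char_values K lam) ->
                             adjoin_field iota (char_values K lam)},
     [/\ bijective sigma,
         {in K, grp_conj lam y =1 gal_conj sigma},
         wedderburn_isom_matrix iota G chi (char_values G chi) d &
         forall x : Fbar, x \in Fchi <->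
           exists2 v : adjoin_field iota (char_values K lam),
             val v = x & sigma v = v]).
Proof.
have E0 : [pchar Fbar] =i pred0 by move=> q; rewrite -hF -(fmorph_pchar iota).
have [/andP[nsKG _] _] := maxgroupP hKmax.
have cGK := sub_cent_maxnormal_abelian hKmax hG'K.
have pK : p.-group K by rewrite /pgroup hKcard pnatX pnat_id.
move=> chi lam Fchi Flam I; split=> [|defI y d Gy defGK <-{d}].
  split.
  - exact: (irr_induced E0 nsKG hKcyc cGK hrho_irr hrho_faithful hlambda).
  - rewrite -hKcard => zeta; apply: charfield_prim_root => //.
    exact: (constituent_char_inj nsKG hKcyc hrho_irr hrho_faithful hlambda).
  - exact: (charfield_sub E0 nsKG hKcyc cGK hrho_irr hrho_faithful hlambda).
  - exact: (gal_stabilizer_isom E0 hFbar nsKG hKcyc cGK hrho_irr hrho_faithful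
      hlambda).
  apply: (gal_stabilizer_cyclic iota E0 nsKG hKcyc cGK hrho_irr hrho_faithful
    hlambda).
  exact: (cyclic_quotient_aut_cyclic_pgroup hp_odd pK hKcyc nsKG cGK).
have Iy : y \in I by rewrite defI.
have [_ [tau gal_tau tau_y]] :=
  gal_stabilizerP iota E0 nsKG hKcyc cGK hrho_irr hrho_faithful hlambda _ Iy.
exists tau; split=> //; first by case: gal_tau.
  (* [y] is exchanged for a representative of its coset of order dividing d; the conjugate of [lam],
     and so [tau], stays the same. *)
  have [y' [Gy' cy' y'd]] :=
    cyclic_pgroup_ext_split hp hp_odd nsKG hKcyc hKcard cGK Gy.
  rewrite -cy' in defGK y'd *.
  apply: (wedderburn_component_matrix hF hFbar nsKG hKcyc cGK hrho_irr
    hrho_faithful hlambda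
    Gy' defGK y'd gal_tau) => h Kh.
  have NG := subsetP (normal_norm nsKG).
  have [k Kk ->] : exists2 k, k \in K & y' = (k * y)%g.
    by apply: kercoset_rcoset; rewrite ?NG.
  by rewrite (grp_conj_charK _ nsKG) // tau_y.
exact: (charfield_fixed E0 hFbar nsKG hKcyc cGK hrho_irr hrho_faithful hlambda
  Gy gal_tau defGK tau_y).
Qed.
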